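(* Let $\Phi$ be a random real $M\times N$ matrix with independent standard normal entries, and denote $R=\frac{N}{M}$. Provided $R>2$, for every $\varepsilon>0$, $\Phi$ has the $\sigma$-strong complement property with $$\sigma=\frac{1}{\sqrt{2}\,e^{1+\varepsilon/(R-2)}}\cdot\frac{N-2M+2}{2^{R/(R-2)}\sqrt{N}},$$ with probability at least $1-e^{-\varepsilon M}$.
   Context: For an $M\times N$ matrix $\Phi$ and $S\subseteq\{1,\ldots,N\}$, $\Phi_S$ is the submatrix of columns indexed by $S$. $\Phi$ satisfies the $\sigma$-strong complement property if $\max\{\lambda_{\min}(\Phi_S\Phi_S^* ),\lambda_{\min}(\Phi_{S^{\mathrm{c}}}\Phi_{S^{\mathrm{c}}}^* )\}\geq\sigma^2$ for every $S\subseteq\{1,\ldots,N\}$, where $\lambda_{\min}$ denotes the smallest eigenvalue of the given $M\times M$ matrix (with $\Phi_S\Phi_S^*=0$ when $S=\emptyset$). *)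

(* Defs.v *)
From HB Require Import structures.
From mathcomp Require Import all_boot all_order all_algebra.
From mathcomp Require Import all_classical all_reals all_analysis.

Set Implicit Arguments.
Unset Strict Implicit.
Unset Printing Implicit Defensive.

Import Order.TTheory GRing.Theory Num.Theory.
Import numFieldNormedType.Exports.

Local Open Scope classical_set_scope.
Local Open Scope ring_scope.

(* The product rule over every finite subfamily; the index type is finite, so
   the finite subfamilies are exactly the sets J. *)
Definition mutually_independent d (T : measurableType d) (R : realType)
    (P : probability T R) (I : finType) (X : I -> {RV P >-> R}) : Prop :=
  forall (J : {set I}) (A : I -> set R), (forall i, measurable (A i)) ->
    P (\bigcap_(i in [set` J]) (X i @^-1` A i)) =
    (\prod_(i in J) P (X i @^-1` A i))%E.

Definition standard_normal d (T : measurableType d) (R : realType)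
    (P : probability T R) (X : {RV P >-> R}) : Prop :=
  forall A : set R, measurable A -> distribution P X A = normal_prob 0 1 A.

Definition random_matrix d (T : measurableType d) (R : realType)
    (P : probability T R) (M N : nat) (X : 'I_M * 'I_N -> {RV P >-> R})
    (w : T) : 'M[R]_(M, N) :=
  \matrix_(i, j) X (i, j) w.

(* The columns indexed by S, in increasing order; for S = set0 this has no
   columns, so that its Gram matrix below is the zero M x M matrix. *)
Definition col_submatrix (R : Type) (M N : nat) (Phi : 'M[R]_(M, N))
    (S : {set 'I_N}) : 'M[R]_(M, #|S|) :=
  colsub (fun k : 'I_#|S| => enum_val k) Phi.

(* A real symmetric matrix of positive size, the only case in which this is
   used, has a nonempty finite set of eigenvalues, so the infimum is the least
   eigenvalue. *)
Definition lambda_min (R : realType) (M : nat) (A : 'M[R]_M) : R :=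
  inf [set a : R | eigenvalue A a].

(* The matrices are real, so the adjoint is the transpose. *)
Definition strong_complement_property (R : realType) (M N : nat) (sigma : R)
    (Phi : 'M[R]_(M, N)) : Prop :=
  forall S : {set 'I_N},
    let PhiS := col_submatrix Phi S in
    let PhiSc := col_submatrix Phi (~: S)%SET in
    sigma ^+ 2 <=
      Num.max (lambda_min (PhiS *m PhiS^T)) (lambda_min (PhiSc *m PhiSc^T)).

(* Main.v *)
(* Let G be an M x (M + a - 1) Gaussian matrix, W = G G^T, and let u be a Gaussian
   vector independent of G. If |v G| <= s for some unit vector v, Cauchy-Schwarz
   gives u W^-1 u^T >= (u . v)^2 / s^2. On the other hand, for a fixed u, rotation
   invariance reduces to u = |u| e_1, where 1 / (u W^-1 u^T) is at least |g B|^2 / |u|^2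
   for the first row g of G and an orthonormal basis B of the kernel of the other
   rows, that is, a chi-square variable with a degrees of freedom. Comparing the two
   estimates of the expectation of exp (- kappa / (u W^-1 u^T)), with
   E exp (- t^2 / (2 Z^2)) >= exp (- t) / 2 for a normal Z and
   E |u|^a <= (M + a - 1)^(a/2), yields
     P (sigma_min G <= s) <= 2 (e sqrt (M + a - 1) s / a)^a.
   Replacing W by W + delta I avoids singular matrices; delta tends to 0 at the end.
   The columns in S and in its complement are independent, so the two bounds
   multiply; the product is largest for the even splitting, by y <= exp (y - 1). The
   union bound over the 2^N sets S costs 2^N, and the factor 4 is absorbed because
   (N - 2M + 2) N / (N - 2M) >= N + 2. *)

Require Import Defs.
From HB Require Import structures.
From mathcomp Require Import all_boot all_order all_algebra.
From mathcomp Require Import all_classical all_reals all_analysis.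
From mathcomp Require Import measurable_realfun.
From mathcomp Require Import ring lra zify.

Set Implicit Arguments.
Unset Strict Implicit.
Unset Printing Implicit Defensive.

Import Order.TTheory GRing.Theory Num.Theory.
Import numFieldNormedType.Exports.

Local Open Scope classical_set_scope.
Local Open Scope ring_scope.

(** * Measurable matrix-valued functions *)

(** The vector [u] replaces a net on the sphere. The bad direction [v] depends on G, but it is only
    met inside the integral over [u] with G fixed, where u . v is standard normal whatever the unit
    vector [v] is; so no union over directions is paid for and no measurable choice of [v] is made.
    Only then are the integrals exchanged, to estimate the same quantity with [u] fixed. The power
    of e in the tail bound is the optimum of e^t t^(-a), at t = a. The number N - 2M + 2 is a total
    excess: with M = m + 1, column sets of m + a and m + b elements have tails of orders a and b,
    and a + b = N - 2m. Rotation invariance, the chi-square Laplace transform and the moment bounds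
    all come from one formula, the change of variables for an invertible matrix
    ([integral_gauss_linear]), applied to an isometry, to a dilation along a subspace and to a
    homothety. *)

Definition measure_matrix_display : measure_display.
Proof. exact: default_measure_display. Qed.

Section matrix_measurable.
Context (R : realType) (m n : nat).

(** Generators of the product sigma-algebra, so that measurability of a matrix-valued map can be
    checked entry by entry. *)
Definition entry_preimages : set (set 'M[R]_(m, n)) :=
  [set X | exists ij, exists2 Y : set R, measurable Y &
     X = (fun A : 'M[R]_(m, n) => A ij.1 ij.2) @^-1` Y].

Let mx0 : <<s entry_preimages >> set0.
Proof. exact: sigma_algebra0. Qed.

Let mxC X : <<s entry_preimages >> X -> <<s entry_preimages >> (~` X).
Proof. exact: sigma_algebraC. Qed.

Let mx_bigcup (F : (set 'M[R]_(m, n))^nat) :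
  (forall i, <<s entry_preimages >> (F i)) ->
  <<s entry_preimages >> (\bigcup_i F i).
Proof. exact: sigma_algebra_bigcup. Qed.

HB.instance Definition _ := @isMeasurable.Build measure_matrix_display
  'M[R]_(m, n) <<s entry_preimages >> mx0 mxC mx_bigcup.

Lemma measurable_entry i j :
  measurable_fun [set: 'M[R]_(m, n)] (fun A => A i j).
Proof.
move=> _ Y mY; rewrite setTI; apply: sub_sigma_algebra.
by exists (i, j), Y.
Qed.

Lemma measurable_mxP d (T : measurableType d) (f : T -> 'M[R]_(m, n)) :
  measurable_fun setT f <-> forall i j, measurable_fun setT (fun t => f t i j).
Proof.
split=> [mf i j|mf].
  exact: (measurableT_comp (measurable_entry i j) mf).
apply: (measurability entry_preimages) => // _ [_ [[i j] [Y mY ->]] <-].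
rewrite setTI; have := mf i j measurableT Y mY; rewrite setTI.
by [].
Qed.

End matrix_measurable.

Section matrix_measurable_ops.
Context (R : realType) d (T : measurableType d).

Lemma measurable_mulmx m n p (f : T -> 'M[R]_(m, n)) (g : T -> 'M[R]_(n, p)) :
  measurable_fun setT f -> measurable_fun setT g ->
  measurable_fun setT (fun t => f t *m g t).
Proof.
move=> /measurable_mxP mf /measurable_mxP mg; apply/measurable_mxP => i j.
under eq_fun do rewrite mxE.
by apply: measurable_sum => k; exact: measurable_funM.
Qed.

Lemma measurable_addmx m n (f g : T -> 'M[R]_(m, n)) :
  measurable_fun setT f -> measurable_fun setT g ->
  measurable_fun setT (fun t => f t + g t).
Proof.
move=> /measurable_mxP mf /measurable_mxP mg; apply/measurable_mxP => i j.
by under eq_fun do rewrite mxE; exact: measurable_funD.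
Qed.

Lemma measurable_trmx m n (f : T -> 'M[R]_(m, n)) :
  measurable_fun setT f -> measurable_fun setT (fun t => (f t)^T).
Proof.
move=> /measurable_mxP mf; apply/measurable_mxP => i j.
under eq_fun do rewrite mxE; exact: mf.
Qed.

Lemma measurable_row_mx m n p (f : T -> 'M[R]_(m, n)) (g : T -> 'M[R]_(m, p)) :
  measurable_fun setT f -> measurable_fun setT g ->
  measurable_fun setT (fun t => row_mx (f t) (g t)).
Proof.
move=> /measurable_mxP mf /measurable_mxP mg; apply/measurable_mxP => i j.
under eq_fun do rewrite mxE.
by case: (fintype.split j) => k; [exact: mf|exact: mg].
Qed.

Lemma measurable_scalar_mx n (f : T -> R) :
  measurable_fun setT f -> measurable_fun setT (fun t => (f t)%:M : 'M[R]_n).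
Proof.
move=> mf; apply/measurable_mxP => i j.
under eq_fun do rewrite mxE.
by case: (i == j); [exact: mf|exact: measurable_cst].
Qed.

Lemma measurable_vec_mx m n (f : T -> 'rV[R]_(m * n)) :
  measurable_fun setT f -> measurable_fun setT (fun t => vec_mx (f t)).
Proof.
move=> /measurable_mxP mf; apply/measurable_mxP => i j.
under eq_fun do rewrite mxE; exact: mf.
Qed.

Lemma measurable_determinant n (f : T -> 'M[R]_n) :
  measurable_fun setT f -> measurable_fun setT (fun t => \det (f t)).
Proof.
move=> /measurable_mxP mf; apply: measurable_sum => s.
apply: measurable_funM => //.
by apply: measurable_prod => i _.
Qed.

(** Together with the determinant, this makes the inverse measurable through Cramer's rule. *)
Lemma measurable_adjugate n (f : T -> 'M[R]_n) :
  measurable_fun setT f -> measurable_fun setT (fun t => \adj (f t)).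
Proof.
move=> mf; apply/measurable_mxP => i j.
under eq_fun do rewrite mxE.
rewrite /cofactor; apply: measurable_funM => //.
apply: measurable_determinant.
move/measurable_mxP : mf => mf; apply/measurable_mxP => k l.
under eq_fun do rewrite !mxE; exact: mf.
Qed.

End matrix_measurable_ops.

(** * Affine change of variables for the iterated Lebesgue integral *)

Section affine_substitution.
Context (R : realType).
Local Notation mu := (@lebesgue_measure R).
Local Open Scope ereal_scope.

(** The image of [mu] under x -> a x + b, scaled by |a|, agrees with [mu] on half-open intervals,
    and these determine the measure. *)
Lemma ge0_integral_affine (a b : R) (f : R -> \bar R) : a != 0%R ->
  measurable_fun setT f -> (forall x, 0 <= f x) ->
  `|a|%:E * \int[mu]_x f (a * x + b)%R = \int[mu]_x f x.
Proof.
move=> a0 mf f0.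
pose h (x : R) := (a * x + b)%R.
have mh : measurable_fun [set: measurableTypeR R] (h : _ -> measurableTypeR R).
  by apply: (@measurable_funD _ R R) => //; exact: measurable_funM.
pose a' : {nonneg R} := NngNum (normr_ge0 a).
pose nu0 : {measure set (measurableTypeR R) -> \bar R} :=
  pushforward mu (h : measurableTypeR R -> measurableTypeR R).
pose nu : {measure set (measurableTypeR R) -> \bar R} := mscale a' (nu0 mh).
have nuE A : measurable A -> mu A = nu A.
  apply: lebesgue_measure_unique => _ [[x y]] _ <-.
  rewrite /nu /= /mscale/= /pushforward /= lebesgue_measure_itv/= lte_fin.
  (* A negative slope reverses the interval, so the closed end passes from the right to the left. *)
  have [an|ap|] := ltgtP a 0%R; last by move/eqP; rewrite (negbTE a0).
    rewrite (_ : h @^-1` _ = `[((y - b) / a)%R, ((x - b) / a)%R[%classic); last first.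
      apply/seteqP; split => z /=; rewrite !in_itv/= /h.
        by rewrite ler_ndivrMr// ltr_ndivlMr// => /andP[? ?]; lra.
      by rewrite ler_ndivrMr// ltr_ndivlMr// => /andP[? ?]; lra.
    rewrite lebesgue_measure_itv/= lte_fin ltr_nM2r ?invr_lt0// ltrD2r.
    case: ifPn => _; last by rewrite mule0.
    by rewrite -!EFinD -EFinM; congr EFin; rewrite ltr0_norm//; field.
  rewrite (_ : h @^-1` _ = `]((x - b) / a)%R, ((y - b) / a)%R]%classic); last first.
    apply/seteqP; split => z /=; rewrite !in_itv/= /h.
      by rewrite ler_pdivlMr// ltr_pdivrMr// => /andP[? ?]; lra.
    by rewrite ler_pdivlMr// ltr_pdivrMr// => /andP[? ?]; lra.
  rewrite lebesgue_measure_itv/= lte_fin ltr_pM2r ?invr_gt0// ltrD2r.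
  case: ifPn => _; last by rewrite mule0.
  by rewrite -!EFinD -EFinM; congr EFin; rewrite gtr0_norm//; field.
transitivity (\int[nu]_x f x).
  rewrite /nu ge0_integral_mscale//= ge0_integral_pushforward//.
by apply: eq_measure_integral => A mA _; exact/esym/nuE.
Qed.

End affine_substitution.

(** * Iterated integrals over row vectors *)

Section iterated_lebesgue.
Context (R : realType).
Local Notation mu := (@lebesgue_measure R).
Local Notation TR := (measurableTypeR R).
Local Open Scope ereal_scope.

Definition consmx n (x : R) (v : 'rV[R]_n) : 'rV[R]_n.+1 :=
  row_mx (x%:M : 'rV_1) v.

Lemma measurable_consmx d (T : measurableType d) n (f : T -> TR)
    (g : T -> 'rV[R]_n) :
  measurable_fun setT f -> measurable_fun setT g ->
  measurable_fun setT (fun t => consmx (f t) (g t)).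
Proof.
move=> mf mg; apply: (@measurable_row_mx R d T 1 1 n (fun t => (f t)%:M)) => //.
exact: measurable_scalar_mx.
Qed.

(** Nested one-dimensional integrals, first coordinate outermost: integration over R^n in a form
    suited to induction on [n]. *)
Fixpoint lint n : ('rV[R]_n -> \bar R) -> \bar R :=
  match n with
  | 0 => fun F => F 0%R
  | n'.+1 => fun F => \int[mu]_x lint (fun v => F (consmx x v))
  end.

Lemma eq_lint n (F G : 'rV[R]_n -> \bar R) : F =1 G -> lint F = lint G.
Proof. by move=> /funext ->. Qed.

Lemma lint_ge0 n (F : 'rV[R]_n -> \bar R) : (forall v, 0 <= F v) -> 0 <= lint F.
Proof.
elim: n F => [|n IH] F F0 //=.
by apply: integral_ge0 => x _; exact: IH.
Qed.

(** The parameter space is arbitrary for the sake of the induction, which absorbs the next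
    coordinate into it. *)
Lemma measurable_lint n d (S : measurableType d) (F : S -> 'rV[R]_n -> \bar R) :
  measurable_fun setT (fun p : S * 'rV[R]_n => F p.1 p.2) ->
  (forall s v, 0 <= F s v) ->
  measurable_fun setT (fun s => lint (F s)).
Proof.
elim: n d S F => [|n IH] d S F mF F0 /=.
  apply: (measurableT_comp mF (g := fun s => (s, 0%R : 'rV[R]_0))).
  exact: measurable_fun_pair.
apply: (measurable_fun_fubini_tonelli_F (m2 := mu)
  (fun p : S * TR => lint (fun v => F p.1 (consmx p.2 v)))).
  apply: (IH _ (S * TR)%type) => [|p v]; last exact: F0.
  apply: (measurableT_comp mF
    (g := fun q : (S * TR) * 'rV[R]_n => (q.1.1, consmx q.1.2 q.2))).
  apply: measurable_fun_pair; first exact: measurableT_comp.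
  by apply: measurable_consmx => //; exact: (@measurableT_comp _ _ _ _ _ TR).
by move=> p; apply: lint_ge0.
Qed.

Lemma lint_exchange n (F : R -> 'rV[R]_n -> \bar R) :
  measurable_fun setT (fun p : TR * 'rV[R]_n => F p.1 p.2) ->
  (forall s v, 0 <= F s v) ->
  \int[mu]_x lint (F x) = lint (fun v => \int[mu]_x F x v).
Proof.
elim: n F => [//|n IH] F mF F0 /=.
have mc : measurable_fun setT
    (fun q : (TR * TR) * 'rV[R]_n => F q.1.1 (consmx q.1.2 q.2)).
  apply: (measurableT_comp mF
    (g := fun q : (TR * TR) * 'rV[R]_n => (q.1.1, consmx q.1.2 q.2))).
  apply: measurable_fun_pair; first exact: (@measurableT_comp _ _ _ _ _ TR).
  by apply: measurable_consmx => //; exact: (@measurableT_comp _ _ _ _ _ TR).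
rewrite (fubini_tonelli (m1 := mu) (m2 := mu)
  (fun p : TR * TR => lint (fun v => F p.1 (consmx p.2 v)))) /=; first last.
- by move=> p; apply: lint_ge0.
- exact: (measurable_lint (S := (TR * TR)%type) (F := fun p v => F p.1 (consmx p.2 v))).
apply: eq_integral => y _; apply: (IH (fun x v => F x (consmx y v))) => //.
apply: (measurableT_comp mF
  (g := fun q : TR * 'rV[R]_n => (q.1, consmx y q.2))).
apply: measurable_fun_pair; first exact: measurable_fst.
by apply: measurable_consmx => //; exact: measurable_snd.
Qed.

Lemma lintZ n (c : R) (F : 'rV[R]_n -> \bar R) : (0 <= c)%R ->
  measurable_fun setT F -> (forall v, 0 <= F v) ->
  lint (fun v => c%:E * F v) = c%:E * lint F.
Proof.
move=> c0; elim: n F => [//|n IH] F mF F0 /=.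
have mc : measurable_fun setT (fun q : TR * 'rV[R]_n => F (consmx q.1 q.2)).
  apply: (measurableT_comp mF) => //.
  by apply: measurable_consmx; [exact: measurable_fst|exact: measurable_snd].
rewrite -ge0_integralZl_EFin//; last 2 first.
- by move=> x _; apply: lint_ge0.
- exact: (measurable_lint (S := TR) (F := fun x v => F (consmx x v))).
apply: eq_integral => x _; rewrite IH//.
apply: (measurableT_comp mF) => //.
by apply: measurable_consmx.
Qed.

End iterated_lebesgue.

(** One step of Gaussian elimination; the Schur complement is the smaller matrix used in the
    induction of [lint_affine]. *)
Lemma det_schur (K : fieldType) n (a : K) (r : 'rV[K]_n) (c : 'cV[K]_n)
    (D : 'M[K]_n) : a != 0 ->
  \det (block_mx a%:M r c D) = a * \det (D - a^-1 *: (c *m r)).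
Proof.
move=> a0.
have -> : block_mx a%:M r c D =
    block_mx 1%:M 0 (a^-1 *: c) 1%:M *m
    block_mx a%:M r 0 (D - a^-1 *: (c *m r)).
  rewrite mulmx_block !mul1mx !mul0mx !addr0 -!scalemxAl mul_mx_scalar scalerA.
  by rewrite mulVf// scale1r addrC subrK.
by rewrite det_mulmx det_lblock det_ublock !det1 !mul1r det_scalar expr1.
Qed.

Section lint_change_of_variables.
Context (R : realType).
Local Notation mu := (@lebesgue_measure R).
Local Notation TR := (measurableTypeR R).
Local Open Scope ereal_scope.

Let measurable_comp_affine n (A : 'M[R]_n) b (F : 'rV[R]_n -> \bar R) :
  measurable_fun setT F -> measurable_fun setT (fun v => F (v *m A + b)%R).
Proof.
move=> mF; apply: (measurableT_comp mF); apply: measurable_addmx => //.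
exact: measurable_mulmx.
Qed.

Let measurable_line d (T : measurableType d) n (f : T -> TR) (r b : 'rV[R]_n) (b0 a : R) :
  measurable_fun setT f ->
  measurable_fun setT (fun t => ((f t - b0) / a *: r + b)%R).
Proof.
move=> mf; apply/measurable_mxP => i j.
under eq_fun do rewrite !mxE.
apply: measurable_funD => //; apply: measurable_funM => //.
by apply: measurable_funM => //; apply: measurable_funB.
Qed.

(** Induction by elimination. For a nonzero pivot [a], the first coordinate is substituted first,
    which costs the factor 1/|a|; for a fixed new first coordinate, the others undergo an affine map
    whose matrix is the Schur complement. *)
Lemma lint_affine n (A : 'M[R]_n) (b : 'rV[R]_n) (F : 'rV[R]_n -> \bar R) :
  A \in unitmx -> measurable_fun setT F -> (forall v, 0 <= F v) ->
  `|\det A|%:E * lint (fun v => F (v *m A + b)%R) = lint F.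
Proof.
elim: n A b F => [|n IH] A b F uA mF F0.
  rewrite det_mx00 normr1 mul1e /=; congr F.
  exact: thinmx0.
have schur (a : R) (r : 'rV[R]_n) (c : 'cV[R]_n) (D : 'M[R]_n) :
    a != 0%R -> block_mx a%:M r c D \in unitmx ->
    `|\det (block_mx a%:M r c D)|%:E *
      lint (fun v : 'rV[R]_n.+1 => F (v *m (block_mx a%:M r c D : 'M[R]_n.+1) + b)%R) = lint F.
  move=> a0 uB.
  rewrite det_schur//=.
  pose b0 : R := lsubmx (b : 'rV[R]_(1 + n)) 0%R 0%R.
  pose b1 : 'rV[R]_n := rsubmx (b : 'rV[R]_(1 + n)).
  pose S := (D - a^-1 *: (c *m r))%R.
  have uS : S \in unitmx.
    by move: uB; rewrite !unitmxE det_schur// unitrM => /andP[].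
  have E x w : (consmx x w *m (block_mx a%:M r c D : 'M[R]_n.+1) + b)%R =
      consmx (a * x + ((w *m c) 0 0 + b0))%R (x *: r + w *m D + b1)%R.
    rewrite /consmx -[b in LHS](@hsubmxK _ 1 1 n) (@mul_row_block _ 1 1 n 1 n).
    rewrite (@add_row_mx _ 1 1 n) addrA; congr (@row_mx _ 1 1 n _ _).
      apply/matrixP => i j; rewrite !ord1 !mxE eqxx mulr1n big_ord1 !mxE/=.
      by rewrite !mulr1n (mulrC x) /b0 mxE.
    by rewrite mul_scalar_mx.
  have mB : measurable_fun setT
      (fun q : TR * 'rV[R]_n => F (consmx q.1 q.2 *m (block_mx a%:M r c D : 'M[R]_n.+1) + b)%R).
    have := measurable_comp_affine (block_mx a%:M r c D : 'M[R]_n.+1) b mF.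
    move=> /measurableT_comp; apply; apply: measurable_consmx.
      exact: measurable_fst.
    exact: measurable_snd.
  have mF' : measurable_fun setT (fun q : TR * 'rV[R]_n => F (consmx q.1 q.2)).
    apply: (measurableT_comp mF).
    by apply: measurable_consmx; [exact: measurable_fst|exact: measurable_snd].
  rewrite (lint_exchange (F := fun x v => F (consmx x v *m (block_mx a%:M r c D : 'M[R]_n.+1) + b)%R))//.
  have step w : \int[mu]_x F (consmx x w *m (block_mx a%:M r c D : 'M[R]_n.+1) + b)%R =
      `|a|^-1%:E * \int[mu]_x F (consmx x (w *m S + ((x - b0) / a *: r + b1)))%R.
    pose H (p : R) := F (consmx p
       ((p - ((w *m c) 0 0 + b0)) / a *: r + (w *m D + b1))%R).
    have mH : measurable_fun setT H.
      apply: (@measurableT_comp _ _ _ TR) mF _ => //; apply: measurable_consmx => //.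
      exact: measurable_line.
    transitivity (\int[mu]_x H (a * x + ((w *m c) 0 0 + b0))%R).
      apply: eq_integral => x _; rewrite E /H -addrA; congr (F (consmx _ (_ *: _ + _)%R)).
      by field.
    have an0 : `|a|%R != 0%R by rewrite normr_eq0.
    have aff : `|a|%:E * \int[mu]_x H (a * x + ((w *m c) 0 0 + b0))%R =
        \int[mu]_x H x.
      by apply: ge0_integral_affine => // x; exact: F0.
    rewrite -[LHS]mul1e -(mulVf an0) EFinM -muleA aff.
    congr (_ * _); apply: eq_integral => x _; rewrite /H; congr (F (consmx _ _)).
    rewrite /S mulmxBr -scalemxAr mulmxA [(w *m c)%R]mx11_scalar mul_scalar_mx.
    rewrite scalerA !addrA; congr (_ + b1)%R.
    rewrite mxE eqxx mulr1n.
    move: ((w *m c)%R 0%R 0%R) (w *m D)%R => y z.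
    by apply/rowP => j; rewrite !mxE; field.
  have mG : measurable_fun setT (fun q : TR * 'rV[R]_n =>
      F (consmx q.1 (q.2 *m S + ((q.1 - b0) / a *: r + b1)))%R).
    apply: (measurableT_comp mF); apply: measurable_consmx.
      exact: measurable_fst.
    apply: measurable_addmx.
      by apply: measurable_mulmx => //; exact: measurable_snd.
    by apply: measurable_line; exact: measurable_fst.
  under eq_lint do rewrite step.
  rewrite lintZ ?invr_ge0//; first last.
  - by move=> v; exact: integral_ge0.
  - exact: (measurable_fun_fubini_tonelli_G (m1 := mu) (fun q : TR * 'rV[R]_n =>
      F (consmx q.1 (q.2 *m S + ((q.1 - b0) / a *: r + b1)))%R)).
  rewrite -lint_exchange//.
  rewrite muleA -EFinM normrM mulrAC divff ?normr_eq0// mul1r.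
  rewrite -ge0_integralZl_EFin//; last 2 first.
  - by move=> x _; exact: lint_ge0.
  - exact: (measurable_lint (S := TR) (F := fun x w => F (consmx x (w *m S + ((x - b0) / a *: r + b1)))%R)).
  apply: eq_integral => x _.
  rewrite (IH S ((x - b0) / a *: r + b1)%R (fun w => F (consmx x w)))//.
  apply: (measurableT_comp mF); exact: measurable_consmx.
pose a : R := ulsubmx (A : 'M[R]_(1 + n)) 0%R 0%R.
have blockE (B : 'M[R]_(1 + n)) :
    B = block_mx (ulsubmx B 0%R 0%R)%:M (ursubmx B) (dlsubmx B) (drsubmx B).
  by rewrite -[LHS]submxK; congr block_mx; exact: mx11_scalar.
have [a0|a0] := eqVneq a 0%R; last first.
  by have := schur a (ursubmx (A : 'M[R]_(1 + n))) (dlsubmx (A : 'M[R]_(1 + n))) (drsubmx (A : 'M[R]_(1 + n))) a0;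
     rewrite -blockE; exact.
pose c : 'cV[R]_n := dlsubmx (A : 'M[R]_(1 + n)).
(* A zero pivot is repaired by adding row [i] of the lower block to the first row; invertibility of
   [A] provides such a row. *)
have [i ci0] : exists i, c i 0%R != 0%R.
  apply/existsP; apply: contraT; rewrite negb_exists => /forallP c0.
  have c0' : c = 0%R.
    by apply/matrixP => i j; rewrite ord1; have := c0 i; rewrite negbK => /eqP ->; rewrite mxE.
  move: uA; rewrite unitmxE (blockE A) -/a a0 -/c c0' (@det_ublock _ 1 n).
  by rewrite det_scalar expr1 mul0r unitr0.
pose w : 'rV[R]_n := delta_mx 0%R i.
pose E : 'M[R]_(1 + n) := block_mx 1%:M w 0 1%:M.
pose B : 'M[R]_n.+1 := E *m A.
have detB : \det B = \det A by rewrite /B det_mulmx /E (@det_ublock _ 1 n) !det1 !mul1r.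
have BE : B = block_mx (c i 0%R)%:M (ursubmx (B : 'M[R]_(1 + n)))
    (dlsubmx (B : 'M[R]_(1 + n))) (drsubmx (B : 'M[R]_(1 + n))).
  rewrite [LHS](blockE B); congr (@block_mx _ 1 n 1 n _%:M _ _ _).
  rewrite /B (blockE A) /E (@mulmx_block _ 1 n 1 n 1 n) (@block_mxKul _ 1 n 1 n) -/a a0 -/c.
  rewrite !mxE big_ord1 !mxE mul0rn mulr0 add0r (bigD1 i)//= !mxE !eqxx mul1r.
  by rewrite big1 ?addr0// => j /negPf ji; rewrite !mxE ji mul0r.
have uB : B \in unitmx by rewrite unitmxE detB -unitmxE.
have := schur (c i 0%R) (ursubmx (B : 'M[R]_(1 + n)))
  (dlsubmx (B : 'M[R]_(1 + n))) (drsubmx (B : 'M[R]_(1 + n))) ci0.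
rewrite -BE => /(_ uB); rewrite detB => <-; congr (_ * _) => /=.
apply: eq_integral => x _.
have mx : measurable_fun setT (fun u => F (consmx x u *m A + b)%R).
  have /measurableT_comp := measurable_comp_affine A b mF; apply.
  exact: measurable_consmx.
(* For a fixed first coordinate [x], the shear [E] only translates the remaining ones by
   [x *: w]. *)
rewrite -[LHS](IH 1%:M (x *: w)%R (fun u => F (consmx x u *m A + b)%R)) ?unitmx1//.
rewrite det1 normr1 mul1e; apply: eq_lint => u.
rewrite mulmx1 /B mulmxA; congr (F (_ *m _ + _)%R).
rewrite /consmx /E (@mul_row_block _ 1 1 n 1 n) !mulmx1 mulmx0 addr0.
by rewrite mul_scalar_mx addrC.
Qed.

End lint_change_of_variables.

(** * Standard Gaussian vectors *)

Section gaussian.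
Context (R : realType).
Local Notation mu := (@lebesgue_measure R).
Local Notation TR := (measurableTypeR R).
Local Notation N01 := (normal_prob (0 : R) 1).
Local Notation pdf := (normal_pdf (0 : R) 1).
Local Open Scope ereal_scope.

(** The Radon-Nikodym derivative and [normal_pdf] have the same integral over every measurable set,
    hence agree almost everywhere. *)
Lemma ge0_integral_normal_prob (m s : R) (f : TR -> \bar R) :
  measurable_fun setT f -> (forall x, 0 <= f x) ->
  \int[normal_prob m s]_x f x = \int[mu]_x (f x * (normal_pdf m s x)%:E).
Proof.
move=> mf f0.
have dom := normal_prob_dominates m s.
rewrite -(Radon_Nikodym_SigmaFinite.change_of_variables dom)//.
have mpdf : measurable_fun [set: TR] (fun x => (normal_pdf m s x)%:E).
  by apply/measurable_EFinP; exact: measurable_normal_pdf.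
have iRN := Radon_Nikodym_SigmaFinite.f_integrable dom.
apply: ae_eq_integral => //.
- by apply: emeasurable_funM => //; exact: measurable_int iRN.
- exact: emeasurable_funM.
- apply: ae_eqe_mul2l; apply: integral_ae_eq => //.
  by move=> A _ mA; rewrite -(Radon_Nikodym_SigmaFinite.f_integral dom).
Qed.

Let cons2 n (p : TR * 'rV[R]_n) : 'rV[R]_n.+1 := consmx p.1 p.2.

Let measurable_cons2 n : measurable_fun setT (@cons2 n).
Proof. by apply: measurable_consmx; [exact: measurable_fst|exact: measurable_snd]. Qed.

HB.instance Definition _ n :=
  isMeasurableFun.Build _ _ _ _ (@cons2 n) (@measurable_cons2 n).

(** The recursion runs along the first coordinate as in [lint], so that the density formula
    [integral_gauss] is a plain induction. *)
Fixpoint gauss n : probability 'rV[R]_n R :=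
  match n with
  | 0 => dirac (0%R : 'rV[R]_0) : probability _ R
  | n'.+1 => distribution (N01 \x gauss n') (@cons2 n') : probability _ R
  end.

Lemma integral_gaussS n (F : 'rV[R]_n.+1 -> \bar R) :
  measurable_fun setT F -> (forall v, 0 <= F v) ->
  \int[gauss n.+1]_v F v = \int[N01]_x \int[gauss n]_v F (consmx x v).
Proof.
move=> mF F0 /=.
rewrite ge0_integral_pushforward//=.
rewrite (fubini_tonelli1 (fun p : TR * 'rV[R]_n => F (cons2 p)))//.
exact: measurableT_comp.
Qed.

Definition sqnorm n (v : 'rV[R]_n) : R := \sum_j v 0%R j ^+ 2.

Lemma measurable_sqnorm d (T : measurableType d) n (f : T -> 'rV[R]_n) :
  measurable_fun setT f -> measurable_fun setT (fun t => sqnorm (f t)).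
Proof.
move=> /measurable_mxP mf; apply: measurable_sum => j.
exact: measurable_funX.
Qed.

Lemma sqnorm_ge0 n (v : 'rV[R]_n) : (0 <= sqnorm v)%R.
Proof. by apply: sumr_ge0 => j _; exact: sqr_ge0. Qed.

Lemma sqnormE n (v : 'rV[R]_n) : sqnorm v = (v *m v^T)%R 0%R 0%R.
Proof. by rewrite mxE; apply: eq_bigr => j _; rewrite mxE expr2. Qed.

Lemma sqnorm_cons n x (v : 'rV[R]_n) : sqnorm (consmx x v) = (x ^+ 2 + sqnorm v)%R.
Proof.
rewrite /sqnorm [LHS](@big_split_ord _ _ _ 1 n) big_ord1/=.
rewrite /consmx (@row_mxEl _ 1 1 n) mxE mulr1n; congr (_ + _)%R.
by apply: eq_bigr => j _; rewrite (@row_mxEr _ 1 1 n).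
Qed.

Definition gauss_density n (v : 'rV[R]_n) : R :=
  normal_peak 1 ^+ n * expR (- (sqnorm v / 2)).

Lemma gauss_density_ge0 n (v : 'rV[R]_n) : (0 <= gauss_density v)%R.
Proof. by rewrite mulr_ge0// ?expR_ge0// exprn_ge0// normal_peak_ge0. Qed.

Lemma gauss_density_cons n x (v : 'rV[R]_n) :
  gauss_density (consmx x v) = (pdf x * gauss_density v)%R.
Proof.
rewrite /gauss_density sqnorm_cons normal_pdfE// /normal_fun subr0 exprS.
rewrite expr1n mulrDl opprD expRD.
rewrite (_ : - x ^+ 2 / (1 *+ 2) = - (x ^+ 2 / 2))%R; last by rewrite mulNr.
by ring.
Qed.

Lemma measurable_gauss_density n : measurable_fun setT (@gauss_density n).
Proof.
apply: measurable_funM => //; apply: measurableT_comp => //.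
apply: measurableT_comp => //; apply: measurable_funM => //.
exact: measurable_sqnorm.
Qed.

Lemma integral_gauss n (F : 'rV[R]_n -> \bar R) :
  measurable_fun setT F -> (forall v, 0 <= F v) ->
  \int[gauss n]_v F v = lint (fun v => F v * (gauss_density v)%:E).
Proof.
elim: n F => [|n IH] F mF F0.
  rewrite /= integral_dirac// diracT mul1e.
  rewrite /gauss_density expr0 mul1r /sqnorm big_ord0 mul0r oppr0 expR0 mule1//.
have mc : measurable_fun setT (fun q : TR * 'rV[R]_n => F (consmx q.1 q.2)).
  by apply: (measurableT_comp mF); exact: measurable_cons2.
have mcx x : measurable_fun setT (fun v : 'rV[R]_n => F (consmx x v)).
  by apply: (measurableT_comp mF); exact: measurable_consmx.
have mg n' : measurable_fun setT (fun v => (@gauss_density n' v)%:E).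
  by apply/measurable_EFinP; exact: measurable_gauss_density.
rewrite integral_gaussS//=.
rewrite ge0_integral_normal_prob; first last.
- by move=> x; exact: integral_ge0.
- under eq_fun do rewrite IH//.
  apply: (measurable_lint (S := TR) (F := fun x v => F (consmx x v) * (gauss_density v)%:E)).
    apply: emeasurable_funM => //.
    by apply: (measurableT_comp (mg n)); exact: measurable_snd.
  by move=> x v; rewrite mule_ge0// lee_fin gauss_density_ge0.
apply: eq_integral => x _; rewrite IH// muleC -lintZ ?normal_pdf_ge0//.
- apply: eq_lint => v.
  by rewrite gauss_density_cons EFinM muleCA.
- exact: (emeasurable_funM (mcx x) (mg n)).
- by move=> v; rewrite mule_ge0// lee_fin gauss_density_ge0.
Qed.

(** The exponential weight is the quotient of the Gaussian densities at [v *m A] and at [v]. It is 1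
    for isometries; for dilations it produces Laplace transforms. *)
Lemma integral_gauss_linear n (A : 'M[R]_n) (F : 'rV[R]_n -> \bar R) :
  A \in unitmx -> measurable_fun setT F -> (forall v, 0 <= F v) ->
  `|\det A|%:E * \int[gauss n]_v
     (F (v *m A) * (expR ((sqnorm v - sqnorm (v *m A)) / 2))%:E) =
  \int[gauss n]_v F v.
Proof.
move=> uA mF F0.
have mA : measurable_fun setT (fun v : 'rV[R]_n => v *m A)%R.
  exact: measurable_mulmx.
have mFA : measurable_fun setT (fun v : 'rV[R]_n => F (v *m A)%R).
  exact: measurableT_comp.
have mg : measurable_fun setT (fun v => (@gauss_density n v)%:E).
  by apply/measurable_EFinP; exact: measurable_gauss_density.
rewrite !integral_gauss//; last 2 first.
- apply: emeasurable_funM => //; apply/measurable_EFinP.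
  apply: measurableT_comp => //; apply: measurable_funM => //.
  by apply: measurable_funB; exact: measurable_sqnorm.
- by move=> v; rewrite mule_ge0// lee_fin expR_ge0.
rewrite -(@lint_affine R n A 0 (fun v => F v * (gauss_density v)%:E))//; last 2 first.
- exact: emeasurable_funM.
- by move=> v; rewrite mule_ge0// lee_fin gauss_density_ge0.
congr (_ * _); apply: eq_lint => v; rewrite addr0 -muleA -EFinM; congr (_ * _%:E).
rewrite /gauss_density mulrCA -expRD; congr (_ * expR _)%R.
by field.
Qed.

Lemma integral_gauss_isometry n (A : 'M[R]_n) (F : 'rV[R]_n -> \bar R) :
  `|\det A|%R = 1%R -> (forall v, sqnorm (v *m A) = sqnorm v) ->
  measurable_fun setT F -> (forall v, 0 <= F v) ->
  \int[gauss n]_v F (v *m A)%R = \int[gauss n]_v F v.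
Proof.
move=> dA nA mF F0.
rewrite -[RHS](@integral_gauss_linear _ A)//; last first.
  by rewrite unitmxE unitfE -normr_eq0 dA oner_eq0.
rewrite dA mul1e; apply: eq_integral => v _.
by rewrite nA subrr mul0r expR0 mule1.
Qed.

End gaussian.

(** * Splitting Gaussian vectors; values on rectangles *)

Section gaussian_product.
Context (R : realType).
Local Notation TR := (measurableTypeR R).
Local Notation N01 := (normal_prob (0 : R) 1).
Local Open Scope ereal_scope.

Lemma consmx_row_mx p q x (u : 'rV[R]_p) (v : 'rV[R]_q) :
  consmx x (row_mx u v) = row_mx (consmx x u) v :> 'rV[R]_(p.+1 + q).
Proof.
rewrite /consmx; have := @row_mxA R 1 1 p q x%:M u v.
move=> /(congr1 (fun A => A : 'rV[R]_(p + q).+1)) ->.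
exact: castmx_id.
Qed.

Lemma consmx0 n x (v : 'rV[R]_n) : consmx x v 0%R ord0 = x.
Proof.
have -> : ord0 = lshift n (ord0 : 'I_1) by exact/val_inj.
by rewrite /consmx (@row_mxEl _ 1 1 n) mxE mulr1n.
Qed.

Lemma consmxS n x (v : 'rV[R]_n) i : consmx x v 0%R (lift ord0 i) = v 0%R i.
Proof. by rewrite -rshift1 /consmx (@row_mxEr _ 1 1 n). Qed.

Lemma integral_gauss0 (F : 'rV[R]_0 -> \bar R) : measurable_fun setT F ->
  \int[gauss R 0]_v F v = F 0%R.
Proof. by move=> mF; rewrite /= integral_dirac// diracT mul1e. Qed.

Lemma integral_gaussD p q (F : 'rV[R]_(p + q) -> \bar R) :
  measurable_fun setT F -> (forall v, 0 <= F v) ->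
  \int[gauss R (p + q)]_w F w =
  \int[gauss R p]_u \int[gauss R q]_v F (row_mx u v).
Proof.
elim: p F => [|p IH] F mF F0.
  rewrite integral_gauss0; last first.
    apply: (measurable_fun_fubini_tonelli_F (m2 := gauss R q)
      (fun z : 'rV[R]_0 * 'rV[R]_q => F (row_mx z.1 z.2))) => //.
    by apply: (measurableT_comp mF); exact: measurable_row_mx.
  by apply: eq_integral => v _; rewrite row_thin_mx.
have mx x : measurable_fun setT (fun w : 'rV[R]_(p + q) => F (consmx x w)).
  by apply: (measurableT_comp mF); exact: measurable_consmx.
have mF2 : measurable_fun setT (fun z : 'rV[R]_p.+1 * 'rV[R]_q => F (row_mx z.1 z.2)).
  by apply: (measurableT_comp mF); exact: measurable_row_mx.
rewrite [LHS](@integral_gaussS R (p + q))//.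
rewrite integral_gaussS; first last.
- by move=> v; exact: integral_ge0.
- exact: (measurable_fun_fubini_tonelli_F (m2 := gauss R q) (fun z : 'rV[R]_p.+1 * 'rV[R]_q => F (row_mx z.1 z.2))).
apply: eq_integral => x _.
rewrite (IH (fun w => F (consmx x w)) (mx x) (fun w => F0 _)).
by apply: eq_integral => u _; apply: eq_integral => v _; rewrite consmx_row_mx.
Qed.

Definition rect n (A : 'I_n -> set R) : set 'rV[R]_n :=
  [set v | forall i, A i (v 0%R i)].

Lemma measurable_rect n (A : 'I_n -> set R) :
  (forall i, measurable (A i)) -> measurable (rect A).
Proof.
move=> mA.
rewrite (_ : rect A = \bigcap_(i in [set: 'I_n]) ((fun v : 'rV[R]_n => v 0%R i) @^-1` A i)).
  apply: fin_bigcap_measurable => //.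
  move=> i _; rewrite -[X in measurable X]setTI.
  exact: measurable_entry.
by apply/seteqP; split => v /= h i; [move=> _|]; exact: h.
Qed.

Lemma rect_generates n : @measurable _ 'rV[R]_n =
  <<s [set X | exists2 A : 'I_n -> set R, (forall i, measurable (A i)) & X = rect A] >>.
Proof.
apply/seteqP; split.
  apply: smallest_sub; first exact: smallest_sigma_algebra.
  move=> _ [[i j] [Y mY ->]]; apply: sub_sigma_algebra => /=.
  exists (fun k => if k == j then Y else setT).
    by move=> k; case: ifP.
  apply/seteqP; split => v /=.
    by rewrite ord1 => h k; case: ifP => // /eqP ->.
  by rewrite ord1 => /(_ j); rewrite eqxx.
apply: smallest_sub; first exact: sigma_algebra_measurable.
by move=> _ [A mA ->]; exact: measurable_rect.
Qed.

Lemma gauss_rect n (A : 'I_n -> set R) : (forall i, measurable (A i)) ->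
  gauss R n (rect A) = \prod_i N01 (A i).
Proof.
elim: n A => [|n IH] A mA.
  rewrite big_ord0 /= diracE mem_set//.
  by case.
rewrite big_ord_recl -IH// -product_measure1E//; last exact: measurable_rect.
  rewrite /= /distribution /pushforward /=; congr (_ _).
  apply/seteqP; split => -[x v] /=.
    move=> h; split; first by have := h ord0; rewrite consmx0.
    by move=> i; have := h (lift ord0 i); rewrite consmxS.
  move=> [h0 h] i.
  have [j ->|->] := unliftP ord0 i; last by rewrite consmx0.
  by rewrite consmxS; exact: h.
exact: mA.
Qed.

End gaussian_product.

(** * The joint law of distinct entries *)

Section gaussian_law.
Context (R : realType) d (T : measurableType d) (P : probability T R).
Context (I : finType) (X : I -> {RV P >-> R}).
Hypothesis X_normal : forall i, standard_normal (X i).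
Hypothesis X_indep : mutually_independent X.
Local Open Scope ereal_scope.

Definition random_row k (h : 'I_k -> I) (w : T) : 'rV[R]_k :=
  \row_j X (h j) w.

Lemma measurable_random_row k (h : 'I_k -> I) :
  measurable_fun setT (random_row h).
Proof.
apply/measurable_mxP => i j.
under eq_fun do rewrite mxE.
exact: measurable_funPT.
Qed.

(** Rectangles form a generating pi-system, and on them independence gives the product that defines
    the Gaussian law. *)
Lemma random_row_gauss k (h : 'I_k -> I) (B : set 'rV[R]_k) :
  injective h -> measurable B ->
  P (random_row h @^-1` B) = gauss R k B.
Proof.
move=> hI mB.
pose Y : {mfun T >-> 'rV[R]_k} :=
  HB.pack (random_row h) (isMeasurableFun.Build _ _ _ _ _ (measurable_random_row h)).
apply: (measure_unique
  [set X | exists2 A : 'I_k -> set R, (forall i, measurable (A i)) & X = rect A]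
  (fun=> setT) (rect_generates R k) _ _ _ (distribution P Y) (gauss R k)) => //.
- move=> _ _ [A mA ->] [A' mA' ->]; exists (fun i => A i `&` A' i).
    by move=> i; exact: measurableI.
  apply/seteqP; split => v /=; first by move=> [h1 h2] i; split.
  by move=> h1; split => i; have [] := h1 i.
- by move=> _; exists (fun=> setT) => //; apply/seteqP; split.
- by rewrite bigcup_const.
- move=> _ [A mA ->]; rewrite [RHS](gauss_rect mA).
  change (P (random_row h @^-1` rect A) = \prod_i normal_prob 0%R 1%R (A i)).
  (* Transports the conditions along [h]: by injectivity [A' (h j)] is [A j], so the product rule
     applies over the image of [h]. *)
  pose A' i := \bigcap_(j in [set j | h j = i]) A j.
  have mA' i : measurable (A' i).
    by apply: fin_bigcap_measurable => // j _; exact: mA.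
  have A'h j : A' (h j) = A j.
    apply/seteqP; split => x; first by apply.
    by move=> Ax j' /= /hI ->.
  rewrite (_ : random_row h @^-1` _ =
    \bigcap_(i in [set` [set h j | j : 'I_k]%SET]) (X i @^-1` A' i)); last first.
    apply/seteqP; split => w /=.
      by move=> H _ /= /imsetP[j _ ->]; rewrite A'h; have := H j; rewrite mxE.
    move=> H j; rewrite mxE -A'h; apply: H.
    by rewrite /= imset_f.
  rewrite X_indep// big_imset/=; last by move=> ? ? _ _; exact: hI.
  by apply: eq_bigr => j _; rewrite A'h; exact: X_normal.
- move=> _; change (P (random_row h @^-1` setT) < +oo).
  by rewrite preimage_setT probability_setT ltry.
Qed.

End gaussian_law.

(** * Regularized Gram matrices *)

Section linear_algebra.
Context (R : realType).

Lemma sqnorm0_eq0 n (v : 'rV[R]_n) : sqnorm v = 0 -> v = 0.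
Proof.
move=> /eqP; rewrite psumr_eq0 => [/allP h|j _]; last exact: sqr_ge0.
apply/rowP => j; rewrite mxE; apply/eqP; rewrite -sqrf_eq0.
exact: h (mem_index_enum _).
Qed.

Lemma sqnorm_gt0 n (v : 'rV[R]_n) : v != 0 -> 0 < sqnorm v.
Proof.
move=> v0; rewrite lt_neqAle sqnorm_ge0 andbT eq_sym.
by apply: contra v0 => /eqP/sqnorm0_eq0 ->.
Qed.

Lemma sqnormZ n a (v : 'rV[R]_n) : sqnorm (a *: v) = a ^+ 2 * sqnorm v.
Proof. by rewrite /sqnorm mulr_sumr; apply: eq_bigr => j _; rewrite mxE exprMn. Qed.

Lemma sqnorm_isometry m n (A : 'M[R]_(m, n)) (v : 'rV[R]_m) :
  A *m A^T = 1%:M -> sqnorm (v *m A) = sqnorm v.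
Proof. by move=> AA; rewrite !sqnormE trmx_mul mulmxA -(mulmxA v) AA mulmx1. Qed.

(** Bessel's inequality: the gap is the squared norm of the part of [v] orthogonal to the columns of
    [B]. *)
Lemma sqnorm_mulmx_le n d (B : 'M[R]_(n, d)) (v : 'rV[R]_n) :
  B^T *m B = 1%:M -> sqnorm (v *m B) <= sqnorm v.
Proof.
move=> BB; rewrite -subr_ge0.
suff -> : sqnorm v - sqnorm (v *m B) = sqnorm (v - v *m B *m B^T).
  exact: sqnorm_ge0.
rewrite !sqnormE trmx_mul.
have -> : (v - v *m B *m B^T) *m (v - v *m B *m B^T)^T =
    v *m v^T - v *m B *m (B^T *m v^T).
  rewrite linearB/= !trmx_mul trmxK mulmxBr !mulmxBl !mulmxA.
  have -> : v *m B *m B^T *m B *m B^T *m v^T = v *m B *m B^T *m v^T.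
    by rewrite -(mulmxA (v *m B)) BB mulmx1.
  by rewrite subrr subr0.
by rewrite [in RHS]mxE [in X in _ = _ + X]mxE.
Qed.

(** The reflection in the hyperplane orthogonal to w = h - |h| e_1. It sends [h] to |h| e_1 because
    these two vectors have the same norm, which gives h . w = |w|^2 / 2. *)
Lemma householder n (h : 'rV[R]_n.+1) : exists Q : 'M[R]_n.+1,
  [/\ Q^T = Q, Q *m Q = 1%:M & h *m Q = consmx (Num.sqrt (sqnorm h)) 0].
Proof.
set s := Num.sqrt (sqnorm h).
pose w := h - consmx s 0.
have [w0|w0] := eqVneq w 0.
  exists 1%:M; rewrite trmx1 mulmx1; split => //.
  by apply/eqP; rewrite mulmx1 -subr_eq0 -/w w0.
have sE : s ^+ 2 = sqnorm h by rewrite sqr_sqrtr// sqnorm_ge0.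
have sw := sqnorm_gt0 w0.
have ww : w *m w^T = (sqnorm w)%:M by rewrite [LHS]mx11_scalar -sqnormE.
have hE : h = consmx (h 0 ord0) (\row_j h 0 (lift ord0 j)).
  apply/rowP => j; have [i ->|->] := unliftP ord0 j; last by rewrite consmx0.
  by rewrite consmxS mxE.
have w00 : w 0 ord0 = h 0 ord0 - s by rewrite mxE [X in _ + X]mxE consmx0.
have wS i : w 0 (lift ord0 i) = h 0 (lift ord0 i).
  by rewrite mxE [X in _ + X]mxE consmxS mxE subr0.
have hw : h *m w^T = (sqnorm w / 2)%:M.
  rewrite [LHS]mx11_scalar; congr _%:M.
  rewrite mxE big_ord_recl; under eq_bigr do rewrite mxE.
  have -> : sqnorm w = sqnorm ( consmx (h 0 ord0 - s) (\row_j h 0 (lift ord0 j))).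
    congr sqnorm; apply/rowP => j; have [i ->|->] := unliftP ord0 j.
      by rewrite consmxS [RHS]mxE wS.
    by rewrite consmx0 w00.
  rewrite sqnorm_cons mxE w00.
  under eq_bigr do rewrite wS -expr2.
  have -> : sqnorm (\row_j h 0 (lift ord0 j)) = \sum_(i < n) h 0 (lift ord0 i) ^+ 2.
    by apply: eq_bigr => j _; rewrite mxE.
  have : s ^+ 2 = h 0 ord0 ^+ 2 + \sum_(i < n) h 0 (lift ord0 i) ^+ 2.
    by rewrite sE /sqnorm big_ord_recl.
  move: (h 0 ord0) (\sum_(i < n) _) => x y sxy.
  by apply: (mulIf (x := 2)) => //; rewrite mulfVK//; lra.
have nw : sqnorm w != 0 by rewrite gt_eqF.
exists (1%:M - (2 / sqnorm w) *: (w^T *m w)); split.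
- by rewrite linearB/= linearZ/= trmx1 trmx_mul trmxK.
- set K := w^T *m w; set c := 2 / _.
  have KK : K *m K = sqnorm w *: K.
    by rewrite /K mulmxA -(mulmxA w^T) ww mul_mx_scalar -scalemxAl.
  rewrite mulmxBl mul1mx mulmxBr -!scalemxAl -scalemxAr KK mulmx1 !scalerA.
  have -> : c * c * sqnorm w = c + c by rewrite /c; field.
  by rewrite scalerDl opprB addrK subrK.
- rewrite mulmxBr mulmx1 -scalemxAr mulmxA hw mul_scalar_mx scalerA.
  have -> : 2 / sqnorm w * (sqnorm w / 2) = 1 by field.
  by rewrite scale1r /w opprB addrC subrK.
Qed.

(** Induction on the rows: a reflection makes the first row a multiple of e_1, a basis for the other
    rows without their first column is padded with a zero row, and the reflection is undone. The
    rank of [H] is arbitrary. *)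
Lemma exists_orthonormal_kernel m d (H : 'M[R]_(m, m + d)) :
  exists B : 'M[R]_(m + d, d), B^T *m B = 1%:M /\ H *m B = 0.
Proof.
elim: m H => [|m IH] H.
  exists (1%:M : 'M[R]_d); rewrite trmx1 mulmx1; split=> //.
  exact: flatmx0.
have [Q [QT QQ hQ]] := householder (usubmx (H : 'M[R]_(1 + m, (m + d).+1))).
pose H' : 'M[R]_(m, 1 + (m + d)) := dsubmx (H : 'M[R]_(1 + m, (m + d).+1)) *m Q.
have [B [BB HB]] := IH (rsubmx H').
pose C : 'M[R]_(1 + (m + d), d) := col_mx 0 B.
exists (Q *m C); split.
  rewrite trmx_mul QT mulmxA -(mulmxA C^T) QQ mulmx1 /C tr_col_mx.
  by rewrite (@mul_row_col _ d 1 (m + d) d) trmx0 mul0mx add0r.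
rewrite mulmxA -[H](@vsubmxK _ 1 m) (@mul_col_mx _ 1 m) hQ (@mul_col_mx _ 1 m).
rewrite -/H' -[H'](@hsubmxK _ m 1) /C /consmx (@mul_row_col _ 1 1 (m + d) d) (@mul_row_col _ m 1 (m + d) d) HB !mul0mx !mulmx0 !addr0.
by rewrite (@col_mx0 _ 1 m).
Qed.

(** Sylvester's identity, from two triangular factorizations of one block matrix. It reduces the
    determinant of a dilation along [d] directions to size [d]. *)
Lemma det_rank_update n d (B : 'M[R]_(n, d)) c :
  \det (1%:M + c *: (B *m B^T)) = \det (1%:M + c *: (B^T *m B)).
Proof.
have E1 : block_mx 1%:M B (- c *: B^T) 1%:M =
    block_mx 1%:M 0 (- c *: B^T) 1%:M *m
    block_mx 1%:M B 0 (1%:M + c *: (B^T *m B)).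
  rewrite mulmx_block !mul1mx !mulmx1 !mul0mx !addr0.
  by rewrite -scalemxAl !scaleNr addrC addrK.
have E2 : block_mx 1%:M B (- c *: B^T) 1%:M =
    block_mx 1%:M B 0 1%:M *m
    block_mx (1%:M + c *: (B *m B^T)) 0 (- c *: B^T) 1%:M.
  rewrite mulmx_block !mul1mx !mulmx1 !mul0mx !add0r.
  by rewrite -scalemxAr !scaleNr addrK.
have := E1; rewrite E2 => /(congr1 determinant).
rewrite !det_mulmx !det_ublock !det_lblock !det1 !mul1r !mulr1.
exact.
Qed.

Definition reg_gram m n (delta : R) (G : 'M[R]_(m, n)) : 'M[R]_m :=
  G *m G^T + delta%:M.

Definition inv_form m n (delta : R) (G : 'M[R]_(m, n)) (u : 'rV[R]_m) : R :=
  (u *m invmx (reg_gram delta G) *m u^T) 0 0.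

Section reg_gram.
Variables (m n : nat) (delta : R) (delta_gt0 : 0 < delta) (G : 'M[R]_(m, n)).
Local Notation W := (reg_gram delta G).

Lemma reg_gram_form v : (v *m W *m v^T) 0 0 = sqnorm (v *m G) + delta * sqnorm v.
Proof.
rewrite /reg_gram mulmxDr mulmxDl mxE; congr (_ + _).
  by rewrite sqnormE trmx_mul !mulmxA.
by rewrite mul_mx_scalar -scalemxAl mxE -sqnormE.
Qed.

Lemma tr_reg_gram : W^T = W.
Proof. by rewrite /reg_gram linearD/= trmx_mul trmxK tr_scalar_mx. Qed.

Lemma reg_gram_unit : W \in unitmx.
Proof.
rewrite unitmxE unitfE; apply/det0P => -[v v0 vW].
have := reg_gram_form v; rewrite vW mul0mx mxE => /eqP; apply/negP.
rewrite lt_eqF//; apply: ltr_wpDl; first exact: sqnorm_ge0.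
by rewrite mulr_gt0// sqnorm_gt0.
Qed.

(** Rewrites u W^-1 u^T as the form W evaluated at u W^-1, where [reg_gram_form] applies. *)
Lemma inv_formE u : inv_form delta G u =
  (u *m invmx W *m W *m (u *m invmx W)^T) 0 0.
Proof.
by rewrite mulmxKV ?reg_gram_unit// trmx_mul trmx_inv tr_reg_gram mulmxA.
Qed.

Lemma inv_form_gt0 u : u != 0 -> 0 < inv_form delta G u.
Proof.
move=> u0; rewrite inv_formE reg_gram_form ltr_wpDl ?sqnorm_ge0//.
rewrite mulr_gt0// sqnorm_gt0//.
apply: contra u0 => /eqP h.
by rewrite -[u](mulmxKV reg_gram_unit) h mul0mx.
Qed.

(* Cauchy-Schwarz for the inner product of [reg_gram delta G]. *)
Lemma inv_form_ge u v r : 0 < r ->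
  sqnorm (v *m G) + delta * sqnorm v <= r ->
  (u *m v^T) 0 0 ^+ 2 / r <= inv_form delta G u.
Proof.
move=> r0 vr; set p := (u *m v^T) 0 0.
(* The form of z - c v is at most q - 2 c p + c^2 r, where q = [inv_form delta G u]; the choice c =
   p / r minimizes this bound. *)
pose z := u *m invmx W; pose y := z - (p / r) *: v.
have zW : z *m W = u by rewrite mulmxKV// reg_gram_unit.
have zWv : (z *m W *m v^T) 0 0 = p by rewrite zW.
have vWz : (v *m W *m z^T) 0 0 = p.
  have -> : v *m W *m z^T = (z *m W *m v^T)^T.
    by rewrite !trmx_mul trmxK tr_reg_gram mulmxA.
  by rewrite mxE.
have := reg_gram_form y.
have -> : (y *m W *m y^T) 0 0 = inv_form delta G u - 2 * (p / r) * p +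
    (p / r) ^+ 2 * (v *m W *m v^T) 0 0.
  have bil c : (z - c *: v) *m W *m (z - c *: v)^T =
      z *m W *m z^T - c *: (z *m W *m v^T) - c *: (v *m W *m z^T)
      + c ^+ 2 *: (v *m W *m v^T).
    rewrite [(_ - _)^T]linearB/= [(_ *: _)^T]linearZ/=.
    rewrite mulmxBr 2!mulmxBl -!scalemxAl -!scalemxAr.
    rewrite mulmxBl -!scalemxAl scalerBr scalerA opprB addrA addrAC.
    by rewrite -expr2; congr (_ + _); rewrite addrAC.
  rewrite /y bil; have := zWv; have := vWz.
  move: (v *m W *m z^T) (z *m W *m v^T) (v *m W *m v^T) => A1 A2 A3 A1p A2p.
  rewrite inv_formE -/z; move: (z *m W *m z^T) => A4.
  by rewrite !mxE A1p A2p; ring.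
move=> E.
have : 0 <= sqnorm (y *m G) + delta * sqnorm y.
  by rewrite addr_ge0 ?sqnorm_ge0// mulr_ge0 ?sqnorm_ge0// ltW.
rewrite -E reg_gram_form.
have := ler_wpM2l (sqr_ge0 (p / r)) vr.
have -> : (p / r) ^+ 2 * r = p ^+ 2 / r by field; rewrite gt_eqF.
have -> : 2 * (p / r) * p = 2 * (p ^+ 2 / r) by field; rewrite gt_eqF.
by lra.
Qed.

Lemma inv_form_isometry (Q : 'M[R]_m) u : Q^T = Q -> Q *m Q = 1%:M ->
  inv_form delta (Q *m G) u = inv_form delta G (u *m Q).
Proof.
move=> QT QQ.
have -> : inv_form delta (Q *m G) u = (u *m invmx (Q *m W *m Q) *m u^T) 0 0.
  rewrite /inv_form /reg_gram trmx_mul QT; congr ((_ *m invmx _ *m _) 0 0).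
  rewrite mulmxDr mulmxDl !mulmxA; congr (_ + _).
  by rewrite mul_mx_scalar -scalemxAl QQ scalemx1.
have XY : (Q *m W *m Q) *m (Q *m invmx W *m Q) = 1%:M.
  by rewrite !mulmxA -(mulmxA _ Q Q) QQ mulmx1 mulmxK ?reg_gram_unit.
have [uX _] := mulmx1_unit XY.
have -> : invmx (Q *m W *m Q) = Q *m invmx W *m Q.
  by rewrite -[LHS]mulmx1 -XY mulKmx.
by rewrite /inv_form trmx_mul QT !mulmxA.
Qed.

End reg_gram.

End linear_algebra.

Lemma measurable_sqrtr (R : realType) d (T : measurableType d) (f : T -> R) :
  measurable_fun setT f -> measurable_fun setT (fun t => Num.sqrt (f t)).
Proof.
have ms : measurable_fun [set: R] (Num.sqrt : R -> R).
  apply: continuous_measurable_fun; exact: sqrt_continuous.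
move=> mf; exact: (measurableT_comp ms mf).
Qed.

(** Away from 0 the inverse of x is x exp (- ln (x^2)), and at 0 both sides vanish. *)
Lemma measurable_invr (R : realType) d (T : measurableType d) (f : T -> R) :
  measurable_fun setT f -> measurable_fun setT (fun t => (f t)^-1).
Proof.
move=> mf.
rewrite (_ : (fun t => _) =
    (fun t => f t * (if 0 < f t ^+ 2 then expR (- ln (f t ^+ 2)) else 0))).
  apply: measurable_funM => //; apply: measurable_fun_ifT => //.
    by apply: measurable_fun_ltr => //; exact: measurable_funX.
  apply: measurableT_comp => //; apply: measurableT_comp => //.
  by apply: measurableT_comp => //; exact: measurable_funX.
apply/funext => t; have [->|ft] := eqVneq (f t) 0; first by rewrite invr0 mul0r.
have f2 : 0 < f t ^+ 2 by rewrite exprn_even_gt0.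
by rewrite f2 expRN lnK ?posrE//; field.
Qed.

(** * Gaussian moments and the inverse exponential *)

Section gaussian_moments.
Context (R : realType).

Lemma measurable_sqnormT n : measurable_fun setT (@sqnorm R n).
Proof. exact: measurable_sqnorm. Qed.

(** The chi-square Laplace transform. The matrix [A] stretches the span of the columns of [B] by a
    factor a with a^2 = 1 + 2k, so that |v A|^2 = |v|^2 + 2k |v B|^2: the weight in
    [integral_gauss_linear] is then exactly the integrand, and det A = a^d. *)
Lemma gauss_exp_sub n d (B : 'M[R]_(n, d)) (k : R) : B^T *m B = 1%:M -> 0 <= k ->
  (\int[gauss R n]_v (expR (- (k * sqnorm (v *m B))))%:E =
   ((Num.sqrt (1 + 2 * k))^-1 ^+ d)%:E)%E.
Proof.
move=> BB k0; set a := Num.sqrt _.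
have a0 : 0 < a by rewrite sqrtr_gt0; lra.
have a2 : a ^+ 2 = 1 + 2 * k by rewrite sqr_sqrtr//; lra.
pose A := 1%:M + (a - 1) *: (B *m B^T).
have dA : \det A = a ^+ d.
  rewrite /A det_rank_update BB scalemx1 -[1%:M + _](raddfD (@scalar_mx R d)).
  by rewrite det_scalar addrC subrK.
have nA v : sqnorm (v *m A) = sqnorm v + 2 * k * sqnorm (v *m B).
  have -> : sqnorm (v *m A) = sqnorm v + (a ^+ 2 - 1) * sqnorm (v *m B).
    have AT : A^T = A by rewrite /A linearD/= linearZ/= trmx1 trmx_mul trmxK.
    rewrite !sqnormE !trmx_mul AT /A.
    set c := a - 1.
    have -> : v *m (1%:M + c *: (B *m B^T)) *m ((1%:M + c *: (B *m B^T)) *m v^T) =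
        v *m v^T + (a ^+ 2 - 1) *: (v *m B *m (B^T *m v^T)).
      rewrite (mulmxDr v) mulmx1 (mulmxDl 1%:M) mul1mx mulmxDl !(mulmxDr _ v^T).
      rewrite -!scalemxAl -!scalemxAr -!scalemxAl !mulmxA scalerA.
      have -> : v *m B *m B^T *m B *m B^T *m v^T = v *m B *m B^T *m v^T.
        by rewrite -(mulmxA (v *m B)) BB mulmx1.
      rewrite -addrA; congr (_ + _).
      by rewrite -!scalerDl; congr (_ *: _); rewrite /c; ring.
    by rewrite mxE [X in _ + X]mxE.
  by rewrite a2 addrAC subrr add0r.
have := @integral_gauss_linear R n A (fun=> 1%E) _ _ _.
rewrite integral_cst//= probability_setT mule1 dA => h.
have ad : `|a ^+ d| = a ^+ d by rewrite ger0_norm// exprn_ge0// ltW.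
have uA : A \in unitmx by rewrite unitmxE dA unitfE expf_neq0// gt_eqF.
have {h} := h uA (measurable_cst _) (fun=> lee01).
rewrite ad; under eq_integral do rewrite mul1e nA.
rewrite (_ : (fun v => _) = (fun v => (expR (- (k * sqnorm (v *m B))))%:E)); last first.
  by apply/funext => v; congr (expR _)%:E; field.
move=> h; rewrite -[LHS]mul1e -(mulVf (x := a ^+ d)); last by rewrite expf_neq0// gt_eqF.
by rewrite EFinM -muleA h mule1 exprVn.
Qed.

(** The same change of variables for the homothety of ratio a; the 2k further powers of a come from
    the homogeneity of the integrand. *)
Lemma gauss_moment_damped n k c : 0 <= c ->
  (\int[gauss R n]_v (sqnorm v ^+ k * expR (- (c * sqnorm v)))%:E =
   ((Num.sqrt (1 + 2 * c))^-1 ^+ (n + k.*2))%:E *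
   \int[gauss R n]_v (sqnorm v ^+ k)%:E)%E.
Proof.
move=> c0; set a := Num.sqrt _.
have a0 : 0 < a by rewrite sqrtr_gt0; lra.
have a2 : a ^+ 2 = 1 + 2 * c by rewrite sqr_sqrtr//; lra.
have mk : measurable_fun [set: 'rV[R]_n] (fun v => (sqnorm v ^+ k)%:E).
  by apply/measurable_EFinP; apply: measurable_funX; exact: measurable_sqnormT.
have me : measurable_fun [set: 'rV[R]_n] (fun v => (sqnorm v ^+ k * expR (- (c * sqnorm v)))%:E).
  apply/measurable_EFinP; apply: measurable_funM.
    by apply: measurable_funX; exact: measurable_sqnormT.
  apply: measurableT_comp => //; apply: measurableT_comp => //.
  by apply: measurable_funM => //; exact: measurable_sqnormT.
rewrite -(@integral_gauss_linear R n a%:M (fun v => (sqnorm v ^+ k)%:E))//; last 2 first.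
- by rewrite unitmxE det_scalar unitfE expf_neq0// gt_eqF.
- by move=> v; rewrite lee_fin exprn_ge0// sqnorm_ge0.
rewrite det_scalar ger0_norm ?exprn_ge0 ?ltW//.
rewrite muleA -EFinM.
under [in RHS]eq_integral => v _.
  rewrite mul_mx_scalar sqnormZ a2 -EFinM.
  rewrite (_ : (1 + 2 * c) * sqnorm v = sqnorm v + 2 * (c * sqnorm v)); last by ring.
  rewrite (_ : (sqnorm v - (sqnorm v + 2 * (c * sqnorm v))) / 2 = - (c * sqnorm v)); last by field.
  rewrite (_ : (sqnorm v + 2 * (c * sqnorm v)) = a ^+ 2 * sqnorm v); last by rewrite a2; ring.
  rewrite exprMn -exprM mul2n -mulrA EFinM.
  over.
rewrite ge0_integralZl_EFin//; last 2 first.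
- by move=> v _; rewrite lee_fin mulr_ge0 ?expR_ge0// exprn_ge0// sqnorm_ge0.
- by rewrite exprn_ge0// ltW.
rewrite muleA -EFinM exprVn exprD invfM.
rewrite (_ : _ * _ = 1); first by rewrite mul1e.
by field; rewrite !expf_neq0// gt_eqF.
Qed.

Lemma bernoulli_le p (b : R) : 0 <= b <= 1 -> 1 - b ^+ p <= p%:R * (1 - b).
Proof.
move=> /andP[b0 b1]; elim: p => [|p IH]; first by rewrite expr0 subrr mul0r.
have h : 0 <= (1 - b ^+ p) * (1 - b).
  by apply: mulr_ge0; rewrite subr_ge0 ?exprn_ile1.
by rewrite exprSr -natr1; nra.
Qed.

(** A difference quotient of [gauss_moment_damped] at c = 0. With y = |v|^2, p = n + 2k and b = (1 +
    2c)^(-1/2), the integral of y^k (1 - exp (- c y)) is 1 - b^p <= p c times that of y^k, while 1 -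
    exp (- c y) >= c y / (1 + c y). Divide by c = 1/(j + 1) and pass to the limit by monotone
    convergence. *)
Lemma gauss_moment_step n k (m : R) : 0 <= m ->
  (\int[gauss R n]_v (sqnorm v ^+ k)%:E <= m%:E ->
   \int[gauss R n]_v (sqnorm v ^+ k.+1)%:E <= ((n + k.*2)%:R * m)%:E)%E.
Proof.
move=> m0 hm; set p := (n + k.*2)%N.
pose g (j : nat) (v : 'rV[R]_n) : \bar R :=
  (sqnorm v ^+ k.+1 / (1 + j.+1%:R^-1 * sqnorm v))%:E.
have y0 (v : 'rV[R]_n) : 0 <= sqnorm v := sqnorm_ge0 v.
have c0 j : 0 < j.+1%:R^-1 :> R by rewrite invr_gt0.
have den (j : nat) (v : 'rV[R]_n) : 0 < 1 + j.+1%:R^-1 * sqnorm v.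
  by apply: ltr_pwDl => //; rewrite mulr_ge0// ltW.
have mg j : measurable_fun setT (g j).
  apply/measurable_EFinP; apply: measurable_funM.
    by apply: measurable_funX; exact: measurable_sqnormT.
  apply: measurable_invr; apply: measurable_funD => //; apply: measurable_funM => //.
  exact: measurable_sqnormT.
have g0 j v : (0 <= g j v)%E.
  by rewrite lee_fin divr_ge0 ?exprn_ge0// ltW.
have ndg v : {homo g ^~ v : j j' / (j <= j')%N >-> (j <= j')%E}.
  move=> j j' jj'; rewrite lee_fin; apply: ler_wpM2l; first exact: exprn_ge0.
  rewrite lef_pV2 ?posrE ?den// lerD2l; apply: ler_wpM2r => //.
  by rewrite lef_pV2 ?posrE// ler_nat.
have limg v : (g j v @[j --> \oo] --> (sqnorm v ^+ k.+1)%:E)%E.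
  apply: cvg_EFin; first exact: nearW.
  rewrite [X in _ --> X](_ : _ = sqnorm v ^+ k.+1 / (1 + 0 * sqnorm v)); last first.
    by rewrite mul0r addr0 divr1.
  apply: cvgMr; apply: cvgV; first by rewrite mul0r addr0.
  apply: cvgD; first exact: cvg_cst.
  by apply: cvgMl; exact: cvg_harmonic.
have ub j : (\int[gauss R n]_v g j v <= (p%:R * m)%:E)%E.
  pose c : R := j.+1%:R^-1.
  have c1 : c <= 1 by rewrite invf_le1// ler1n.
  have cj : 0 < c := c0 j.
  set mk := (\int[gauss R n]_v (sqnorm v ^+ k)%:E)%E.
  have mk0 : (0 <= mk)%E.
    by apply: integral_ge0 => v _; rewrite lee_fin exprn_ge0.
  have mkf : mk \is a fin_num by rewrite ge0_fin_numE// (le_lt_trans hm)// ltry.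
  have msk : measurable_fun [set: 'rV[R]_n] (fun v => (sqnorm v ^+ k)%:E).
    by apply/measurable_EFinP; apply: measurable_funX; exact: measurable_sqnormT.
  pose b := (Num.sqrt (1 + 2 * c))^-1.
  have mexp : measurable_fun [set: 'rV[R]_n] (fun v => (expR (- (c * sqnorm v)))).
    apply: measurableT_comp => //; apply: measurableT_comp => //.
    by apply: measurable_funM => //; exact: measurable_sqnormT.
  have md : measurable_fun [set: 'rV[R]_n] (fun v => (sqnorm v ^+ k * expR (- (c * sqnorm v)))%:E).
    by apply/measurable_EFinP; apply: measurable_funM => //; exact/measurable_EFinP.
  have me : measurable_fun [set: 'rV[R]_n] (fun v => (sqnorm v ^+ k * (1 - expR (- (c * sqnorm v))))%:E).
    apply/measurable_EFinP; apply: measurable_funM; first exact/measurable_EFinP.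
    exact: measurable_funB.
  have e0 (v : 'rV[R]_n) : 0 <= 1 - expR (- (c * sqnorm v)).
    rewrite subr_ge0 -[leRHS]expR0 ler_expR oppr_le0.
    exact: mulr_ge0 (ltW cj) (y0 v).
  have le1 : (c%:E * \int[gauss R n]_v g j v <=
      \int[gauss R n]_v (sqnorm v ^+ k * (1 - expR (- (c * sqnorm v))))%:E)%E.
    rewrite -ge0_integralZl_EFin//; last exact: ltW.
    apply: ge0_le_integral => //.
    - by move=> v _; rewrite mule_ge0// lee_fin ltW.
    - by apply: emeasurable_funM.
    - move=> v _; rewrite -EFinM lee_fin exprSr -!mulrA mulrCA.
      apply: ler_wpM2l; first exact: exprn_ge0.
      have : expR (- (c * sqnorm v)) <= (1 + c * sqnorm v)^-1.
        by rewrite expRN lef_pV2 ?posrE ?expR_gt0 ?den// expR_ge1Dx.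
      rewrite -/c mulrA; have := den j v; rewrite -/c => dv.
      have -> : c * sqnorm v / (1 + c * sqnorm v) = 1 - (1 + c * sqnorm v)^-1.
        by field; rewrite gt_eqF.
      by rewrite lerD2l lerN2.
  have sumE : (\int[gauss R n]_v (sqnorm v ^+ k * (1 - expR (- (c * sqnorm v))))%:E
      + (b ^+ p)%:E * mk = mk)%E.
    rewrite -gauss_moment_damped ?ltW// -ge0_integralD//; last 2 first.
    - by move=> v _; rewrite lee_fin mulr_ge0// exprn_ge0.
    - by move=> v _; rewrite lee_fin mulr_ge0 ?expR_ge0// exprn_ge0.
    by apply: eq_integral => v _; rewrite -EFinD -mulrDr subrK mulr1.
  (* After squaring this is (1 - c)^2 (1 + 2c) = 1 - 3 c^2 + 2 c^3 <= 1, which holds for 0 <= c <=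
     1. *)
  have b1 : 1 - c <= b.
    have s0 : 0 < Num.sqrt (1 + 2 * c) by rewrite sqrtr_gt0; lra.
    rewrite /b -[leRHS]mul1r ler_pdivlMr// -(@expr_le1 _ 2)//; last first.
      by rewrite mulr_ge0 ?(ltW s0)// subr_ge0.
    by rewrite exprMn sqr_sqrtr; nra.
  have bp : 1 - b ^+ p <= p%:R * c.
    have b01 : 0 <= b <= 1.
      rewrite invr_ge0 sqrtr_ge0/= invf_le1 ?sqrtr_gt0; last by lra.
      by rewrite -[leLHS]sqrtr1 ler_wsqrtr//; lra.
    apply: le_trans (bernoulli_le p b01) _.
    by rewrite ler_wpM2l//; lra.
  have le2 : (\int[gauss R n]_v (sqnorm v ^+ k * (1 - expR (- (c * sqnorm v))))%:E
      <= (p%:R * c)%:E * mk)%E.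
    move: sumE; rewrite -(fineK mkf).
    move: (\int[gauss R n]_v _)%E => [r| |]//=.
    rewrite -!EFinM -EFinD => -[sumE]; rewrite lee_fin.
    have -> : r = (1 - b ^+ p) * fine mk by rewrite mulrBl mul1r -{1}sumE addrK.
    by apply: ler_wpM2r => //; exact: fine_ge0.
  have := le_trans le1 le2.
  rewrite [(p%:R * c)%R]mulrC EFinM -muleA lee_pmul2l ?lte_fin// => /le_trans; apply.
  by rewrite EFinM; apply: lee_wpmul2l => //; rewrite lee_fin.
rewrite (_ : (fun v => _) = (fun v => limn (g ^~ v))); last first.
  by apply/funext => v; apply/esym/cvg_lim => //; exact: limg.
have := cvg_monotone_convergence (mu := gauss R n) measurableT mg (fun j v _ => g0 j v) (fun v _ => ndg v).
move=> /[dup] /cvgP h /cvg_lim <-//.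
by apply: lime_le => //; apply: nearW.
Qed.

Lemma gauss_moment_le n k :
  (\int[gauss R n]_v (sqnorm v ^+ k)%:E <= (\prod_(i < k) (n + i.*2)%:R)%:E)%E.
Proof.
elim: k => [|k IH].
  rewrite big_ord0; under eq_integral do rewrite expr0.
  by rewrite integral_cst//= probability_setT mule1.
rewrite big_ord_recr/= mulrC; apply: gauss_moment_step => //.
exact: prodr_ge0.
Qed.

(** The factors of index i and d - 1 - i have arithmetic mean n + d - 1; the square of the product
    pairs them. *)
Lemma prod_arith_le n d : (0 < n)%N ->
  (\prod_(i < d) (n + i.*2) <= (n + d - 1) ^ d)%N.
Proof.
move=> n0.
rewrite -(leq_sqr (\prod_(i < d) _)) -!mulnn.
rewrite {2}(reindex_inj rev_ord_inj) -big_split/= -expnMn.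
rewrite -[X in (_ <= _ ^ X)%N]card_ord -prod_nat_const.
apply: leq_prod => i _.
have := ltn_ord i; move: (nat_of_ord i) => k kd.
have [+ _] := nat_AGM2 (n + k.*2) (n + (d - k.+1).*2).
have -> : (n + k.*2 + (n + (d - k.+1).*2) = 2 * (n + d - 1))%N by lia.
by rewrite expnMn -mulnn leq_pmul2l.
Qed.

(** Jensen's inequality for the square root, in the form y <= y^2 / (2c) + c / 2 with y = |v|^d and
    [c] the claimed bound; the mean of y^2 is at most c^2 by the even moments. *)
Lemma gauss_norm_moment n d : (0 < n)%N ->
  (\int[gauss R n]_v (Num.sqrt (sqnorm v) ^+ d)%:E <=
   (Num.sqrt (n + d - 1)%:R ^+ d)%:E)%E.
Proof.
move=> n0.
have [->|d0] := posnP d.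
  rewrite expr0; under eq_integral do rewrite expr0.
  by rewrite integral_cst//= probability_setT mule1.
set c := Num.sqrt (n + d - 1)%:R ^+ d.
have c0 : 0 < c by rewrite exprn_gt0// sqrtr_gt0 ltr0n; lia.
have c2 : c ^+ 2 = ((n + d - 1) ^ d)%:R.
  by rewrite /c exprAC sqr_sqrtr// natrX.
have ms : measurable_fun [set: 'rV[R]_n] (fun v => (sqnorm v ^+ d / (2 * c))%:E).
  apply/measurable_EFinP; apply: measurable_funM => //.
  by apply: measurable_funX; exact: measurable_sqnormT.
apply: (@le_trans _ _ (\int[gauss R n]_v ((sqnorm v ^+ d / (2 * c))%:E + (c / 2)%:E))%E).
  apply: ge0_le_integral => //.
  - apply/measurable_EFinP; apply: measurable_funX.
    exact: measurable_sqrtr (@measurable_sqnormT n).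
  - exact: emeasurable_funD.
  - move=> v _; rewrite lee_fin -subr_ge0.
    set y := Num.sqrt _ ^+ d.
    have -> : sqnorm v ^+ d = y ^+ 2 by rewrite /y exprAC sqr_sqrtr// sqnorm_ge0.
    have -> : y ^+ 2 / (2 * c) + c / 2 - y = (y - c) ^+ 2 / (2 * c).
      by field; rewrite gt_eqF.
    by rewrite divr_ge0 ?sqr_ge0// mulr_ge0// ltW.
rewrite ge0_integralD//; last 2 first.
- by move=> v _; rewrite lee_fin divr_ge0 ?exprn_ge0 ?sqnorm_ge0// mulr_ge0// ltW.
- by move=> v _; rewrite lee_fin divr_ge0// ltW.
rewrite integral_cst//= probability_setT mule1.
under eq_integral do rewrite mulrC EFinM.
rewrite ge0_integralZl_EFin//; last 3 first.
- by move=> v _; rewrite lee_fin exprn_ge0// sqnorm_ge0.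
- by apply/measurable_EFinP; apply: measurable_funX; exact: measurable_sqnormT.
- by rewrite invr_ge0 mulr_ge0// ltW.
have h : (\int[gauss R n]_v (sqnorm v ^+ d)%:E <= (c ^+ 2)%:E)%E.
  apply: le_trans (gauss_moment_le n d) _.
  by rewrite c2 lee_fin -natr_prod ler_nat prod_arith_le.
apply: (@le_trans _ _ ((2 * c)^-1%:E * (c ^+ 2)%:E + (c / 2)%:E)%E).
  by rewrite leeD2r// lee_pmul2l// ?lte_fin ?invr_gt0 ?mulr_gt0.
rewrite -EFinM -EFinD lee_fin le_eqVlt; apply/orP; left; apply/eqP.
by field; rewrite gt_eqF.
Qed.

End gaussian_moments.

(** * The test function exp (- kappa / q) and its mean for a normal variable *)

Section truncated_inverse_exponential.
Context (R : realType).

(** The convention for division by 0 would give the value 1 at q = 0; the value 0 on q <= 0 keeps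
    [psi] monotone. *)
Definition psi (kappa q : R) : R := if 0 < q then expR (- (kappa / q)) else 0.

Lemma psi_ge0 kappa q : 0 <= psi kappa q.
Proof. by rewrite /psi; case: ifP => // _; exact: expR_ge0. Qed.

Lemma le_psi kappa q q' : 0 <= kappa -> q <= q' -> psi kappa q <= psi kappa q'.
Proof.
move=> k0 qq'; rewrite /psi; case: ifPn => q0; last by case: ifP => // _; exact: expR_ge0.
rewrite (lt_le_trans q0 qq') ler_expR lerN2 ler_wpM2l// lef_pV2// posrE//.
exact: lt_le_trans q0 qq'.
Qed.

Lemma measurable_psi d (T : measurableType d) kappa (f : T -> R) :
  measurable_fun setT f -> measurable_fun setT (fun t => psi kappa (f t)).
Proof.
move=> mf; apply: measurable_fun_ifT => //; first exact: measurable_fun_ltr.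
apply: measurableT_comp => //; apply: measurableT_comp => //.
by apply: measurable_funM => //; exact: measurable_invr.
Qed.

Lemma ge0_integral_shift (b : R) (f : R -> \bar R) :
  measurable_fun setT f -> (forall x, 0 <= f x)%E ->
  (\int[lebesgue_measure]_x f (x + b)%R = \int[lebesgue_measure]_x f x)%E.
Proof.
move=> mf f0; rewrite -[RHS](@ge0_integral_affine R 1 b f) ?oner_eq0//.
by rewrite normr1 mul1e; apply: eq_integral => x _; rewrite mul1r.
Qed.

(* For x >= sqrt t, completing the square,
   t^2/(2x^2) + x^2/2 = t + (x - t/x)^2/2 <= t + 2 (x - sqrt t)^2,
   so the integrand dominates the density of a normal variable centred at
   sqrt t; the half line x <= - sqrt t is symmetric. *)
Lemma normal_psi_ge (t : R) : 0 < t ->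
  ((expR (- t) / 2)%:E <=
   \int[normal_prob (0 : R) 1]_x (psi (t ^+ 2 / 2) (x ^+ 2))%:E)%E.
Proof.
move=> t0; set tau := Num.sqrt t.
have tau0 : 0 < tau by rewrite sqrtr_gt0.
have tau2 : tau ^+ 2 = t by rewrite sqr_sqrtr// ltW.
have mpsi : measurable_fun [set: R] (fun x : R => psi (t ^+ 2 / 2) (x ^+ 2)).
  by apply: measurable_psi; exact: measurable_funX.
rewrite ge0_integral_normal_prob; last 2 first.
- exact/measurable_EFinP.
- by move=> x; rewrite lee_fin psi_ge0.
pose h (x : R) := psi (t ^+ 2 / 2) (x ^+ 2) * normal_pdf 0 1 x.
have h0 x : 0 <= h x by rewrite mulr_ge0 ?psi_ge0 ?normal_pdf_ge0.
have mh : measurable_fun [set: R] h.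
  by apply: measurable_funM => //; exact: measurable_normal_pdf.
have hN x : h (- x) = h x.
  by rewrite /h sqrrN !normal_pdfE//= /normal_fun !subr0 sqrrN.
have peak : normal_peak (2^-1 : R) = 2 * normal_peak 1.
  rewrite /normal_peak (_ : (2^-1 ^+ 2 * pi *+ 2) = 2^-1 ^+ 2 * (1 ^+ 2 * pi *+ 2)).
    by rewrite sqrtrM ?sqr_ge0// sqrtr_sqr ger0_norm ?invr_ge0// invfM invrK.
  by ring.
(* Standard deviation 1/2 matches exp (- 2 y^2), and the division by 2 offsets the doubled peak. The
   total mass of [p] is the lower bound sought. *)
pose p (y : R) := expR (- t) / 2 * normal_pdf 0 2^-1 y.
have key y : 0 <= y -> p y <= h (y + tau).
  move=> y0; rewrite /p /h !normal_pdfE//= peak /normal_fun !subr0.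
  have x0 : 0 < y + tau by rewrite ltr_wpDl.
  rewrite /psi (exprn_gt0 2 x0).
  rewrite (_ : expR (- t) / 2 * (2 * normal_peak 1 * expR (- y ^+ 2 / (2^-1 ^+ 2 *+ 2))) =
     normal_peak 1 * (expR (- t) * expR (- y ^+ 2 / (2^-1 ^+ 2 *+ 2)))); last by field.
  rewrite [leRHS]mulrCA; apply: ler_wpM2l; first exact: normal_peak_ge0.
  rewrite -!expRD ler_expR -tau2.
  rewrite -subr_ge0.
  have -> : - ((tau ^+ 2) ^+ 2 / 2 / (y + tau) ^+ 2) + - (y + tau) ^+ 2 / (1 ^+ 2 *+ 2) -
      (- tau ^+ 2 + - y ^+ 2 / (2^-1 ^+ 2 *+ 2)) =
      y ^+ 2 * (2 ^+ 2 - ((y + tau * 2) / (y + tau)) ^+ 2) / 2.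
    by field; rewrite gt_eqF.
  rewrite !mulr_ge0 ?sqr_ge0// subr_ge0 ler_pXn2r ?nnegrE//.
    by rewrite ler_pdivrMr//; lra.
  by rewrite divr_ge0 ?ltW//; lra.
pose h1 (x : R) := if tau <= x then h x else 0.
pose h2 (x : R) := if x <= - tau then h x else 0.
have mh1 : measurable_fun [set: R] h1.
  by apply: measurable_fun_ifT => //; exact: measurable_fun_ler.
have mh2 : measurable_fun [set: R] h2.
  by apply: measurable_fun_ifT => //; exact: measurable_fun_ler.
have h10 x : 0 <= h1 x by rewrite /h1; case: ifP.
have h20 x : 0 <= h2 x by rewrite /h2; case: ifP.
apply: (@le_trans _ _ (\int[lebesgue_measure]_x ((h1 x)%:E + (h2 x)%:E))%E); last first.
  apply: ge0_le_integral => //.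
  - by move=> x _; rewrite adde_ge0// lee_fin.
  - by apply: emeasurable_funD; exact/measurable_EFinP.
  - by apply/measurable_EFinP.
  - move=> x _; rewrite -EFinD lee_fin /h1 /h2 -/(h x).
    case: ifPn => x1; case: ifPn => x2; rewrite ?addr0 ?add0r//.
    by exfalso; lra.
rewrite ge0_integralD//; last 4 first.
- by move=> x _; rewrite lee_fin.
- by apply/measurable_EFinP.
- by move=> x _; rewrite lee_fin.
- by apply/measurable_EFinP.
(* Moved by [tau] towards the origin, the two half lines meet at 0, so together they carry the whole
   mass of [p]. *)
rewrite -(ge0_integral_shift tau (f := fun x => (h1 x)%:E))//; last exact/measurable_EFinP.
rewrite -(ge0_integral_shift (- tau) (f := fun x => (h2 x)%:E))//; last exact/measurable_EFinP.
have ms c : measurable_fun [set: R] (fun x : R => x + c).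
  exact: measurable_funD.
rewrite -ge0_integralD//; last 4 first.
- by move=> x _; rewrite lee_fin.
- by apply/measurable_EFinP; exact: (measurableT_comp mh1 (ms tau)).
- by move=> x _; rewrite lee_fin.
- by apply/measurable_EFinP; exact: (measurableT_comp mh2 (ms (- tau))).
have -> : (expR (- t) / 2)%:E = (\int[lebesgue_measure]_x (p x)%:E)%E.
  under eq_integral do rewrite EFinM.
  rewrite ge0_integralZl_EFin//.
  - by rewrite integral_normal_pdf mule1.
  - by move=> x _; rewrite lee_fin normal_pdf_ge0.
  - by apply/measurable_EFinP; exact: measurable_normal_pdf.
apply: ge0_le_integral => //.
- by move=> x _; rewrite lee_fin mulr_ge0 ?normal_pdf_ge0// divr_ge0// expR_ge0.
- by apply/measurable_EFinP; apply: measurable_funM => //; exact: measurable_normal_pdf.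
- apply: emeasurable_funD; apply/measurable_EFinP.
    exact: (measurableT_comp mh1 (ms tau)).
  exact: (measurableT_comp mh2 (ms (- tau))).
- move=> y _; rewrite -EFinD lee_fin.
  have [y0|y0] := leP 0 y.
    by rewrite (le_trans (key y y0))// /h1 lerDr y0 lerDl.
  have -> : p y = p (- y) by rewrite /p !normal_pdfE//= /normal_fun !subr0 sqrrN.
  have y0' : 0 <= - y by rewrite oppr_ge0 ltW.
  rewrite (le_trans (key _ y0'))// -hN opprD opprK /h2.
  by rewrite gerDr (ltW y0) lerDr.
Qed.

End truncated_inverse_exponential.

(** * Rotation invariance *)

Section gaussian_invariance.
Context (R : realType).

(** Polarization: the symmetric matrix A A^T - 1 has a vanishing quadratic form. *)
Lemma isometry_mulmx_tr n (A : 'M[R]_n) :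
  (forall v : 'rV[R]_n, sqnorm (v *m A) = sqnorm v) -> A *m A^T = 1%:M.
Proof.
move=> nA; pose D := A *m A^T - 1%:M.
have DT : D^T = D by rewrite /D linearB/= trmx_mul trmxK trmx1.
pose bl (a b : 'rV[R]_n) := (a *m D *m b^T) 0 0.
have bl0 v : bl v v = 0.
  rewrite /bl /D mulmxBr mulmx1 mulmxBl mxE [X in _ + X]mxE -sqnormE -nA.
  by rewrite sqnormE trmx_mul !mulmxA subrr.
have blD a b c e : bl (a + b) (c + e) = bl a c + bl b c + (bl a e + bl b e).
  by rewrite /bl [(c + e)^T]linearD/= mulmxDl mulmxDr !mulmxDl !mxE.
have blE i j : bl (delta_mx 0 i) (delta_mx 0 j) = D i j.
  by rewrite /bl -rowE trmx_delta -colE !mxE.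
have D0 i j : D i j = 0.
  have Dii k : D k k = 0 by rewrite -blE bl0.
  have Dji : D j i = D i j by rewrite -[in LHS]DT mxE.
  have := bl0 (delta_mx 0 i + delta_mx 0 j).
  by rewrite blD !blE !Dii Dji; lra.
apply/eqP; rewrite -subr_eq0; apply/eqP/matrixP => i j.
by rewrite -/D D0 mxE.
Qed.

(** Stated for linear maps, not matrices, to cover maps that pass through [vec_mx] and [mxvec]. *)
Lemma integral_gauss_linear_isometry n (f : 'rV[R]_n -> 'rV[R]_n)
    (F : 'rV[R]_n -> \bar R) :
  linear f -> (forall v, sqnorm (f v) = sqnorm v) ->
  measurable_fun setT F -> (forall v, 0 <= F v)%E ->
  (\int[gauss R n]_v F (f v) = \int[gauss R n]_v F v)%E.
Proof.
move=> lf nf mF F0.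
pose L : {linear 'rV[R]_n -> 'rV[R]_n} := HB.pack f (GRing.isLinear.Build _ _ _ _ _ lf).
pose A := lin1_mx L.
have fE v : f v = v *m A by rewrite mul_rV_lin1.
have AA : A *m A^T = 1%:M by apply: isometry_mulmx_tr => v; rewrite -fE.
have dA : `|\det A| = 1.
  apply/eqP; rewrite -(sqrp_eq1 (normr_ge0 _)).
  by rewrite real_normK ?num_real// expr2 -{2}det_tr -det_mulmx AA det1.
rewrite -[RHS](@integral_gauss_isometry R n A)//; last by move=> v; rewrite -fE.
by apply: eq_integral => v _; rewrite fE.
Qed.

(** A Householder reflection takes [v] to e_1, which turns u . v into the first coordinate. *)
Lemma integral_gauss_dot n (v : 'rV[R]_n) (F : R -> \bar R) :
  sqnorm v = 1 -> measurable_fun setT F -> (forall x, 0 <= F x)%E ->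
  (\int[gauss R n]_u F ((u *m v^T) 0 0)%R = \int[normal_prob (0 : R) 1]_x F x)%E.
Proof.
case: n v => [|n] v v1 mF F0.
  by move: v1; rewrite /sqnorm big_ord0 => /eqP; rewrite eq_sym oner_eq0.
have [Q [QT QQ vQ]] := householder v.
have uE u : (u *m v^T) 0 0 = (u *m Q) 0 ord0.
  have -> : u *m v^T = (u *m Q) *m (v *m Q)^T.
    by rewrite trmx_mul QT mulmxA -(mulmxA u) QQ mulmx1.
  have trE (w : 'rV[R]_n.+1) j : w^T j 0 = w 0 j by rewrite [LHS]mxE.
  rewrite vQ v1 sqrtr1 mxE big_ord_recl trE consmx0 mulr1 big1 ?addr0//.
  by move=> j _; rewrite trE consmxS [X in _ * X]mxE mulr0.
under eq_integral do rewrite uE.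
rewrite (@integral_gauss_linear_isometry n.+1 (fun u => u *m Q) (fun w => F (w 0 ord0)))//; first last.
- by apply: measurableT_comp => //; exact: measurable_entry.
- by move=> u; rewrite sqnorm_isometry// QT.
- by move=> a u w; rewrite /= mulmxDl -scalemxAl.
rewrite integral_gaussS//; last by apply: measurableT_comp => //; exact: measurable_entry.
apply: eq_integral => x _; under eq_integral do rewrite consmx0.
by rewrite integral_cst//= probability_setT mule1.
Qed.

Lemma sqnorm_mxvec m n (X : 'M[R]_(m, n)) :
  sqnorm (mxvec X) = \sum_i \sum_j X i j ^+ 2.
Proof.
rewrite /sqnorm (reindex _ (curry_mxvec_bij m n))/= pair_bigA/=.
by apply: eq_bigr => -[i j] _; rewrite mxvecE.
Qed.

Lemma integral_gauss_orthogonal m n (Q : 'M[R]_m) (F : 'M[R]_(m, n) -> \bar R) :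
  Q^T *m Q = 1%:M -> measurable_fun setT F -> (forall X, 0 <= F X)%E ->
  (\int[gauss R (m * n)]_r F (Q *m vec_mx r) =
   \int[gauss R (m * n)]_r F (vec_mx r))%E.
Proof.
move=> QQ mF F0.
rewrite -(@integral_gauss_linear_isometry _ (fun r => mxvec (Q *m vec_mx r)) (fun r => F (vec_mx r)))//.
- by apply: eq_integral => r _; rewrite mxvecK.
- by move=> a u v; rewrite !linearP.
- move=> v; rewrite -[in RHS](vec_mxK v) !sqnorm_mxvec exchange_big [RHS]exchange_big.
  apply: eq_bigr => j _.
  have colE' (Y : 'M[R]_(m, n)) : \sum_i Y i j ^+ 2 = sqnorm (col j Y)^T.
    by apply: eq_bigr => i _; rewrite !mxE.
  rewrite !colE' !colE -mulmxA trmx_mul sqnorm_isometry//.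
  by rewrite trmxK.
- by apply: (measurableT_comp mF); exact: measurable_vec_mx.
Qed.

Lemma sqnorm_row_mx p q (u : 'rV[R]_p) (v : 'rV[R]_q) :
  sqnorm (row_mx u v) = sqnorm u + sqnorm v.
Proof.
rewrite /sqnorm big_split_ord/=; congr (_ + _); apply: eq_bigr => j _.
  by rewrite row_mxEl.
by rewrite row_mxEr.
Qed.

Lemma measurable_col_mx d (T : measurableType d) m1 m2 n
    (f : T -> 'M[R]_(m1, n)) (g : T -> 'M[R]_(m2, n)) :
  measurable_fun setT f -> measurable_fun setT g ->
  measurable_fun setT (fun t => col_mx (f t) (g t)).
Proof.
move=> mf mg; under eq_fun do rewrite -[col_mx _ _]trmxK tr_col_mx.
by apply: measurable_trmx; apply: measurable_row_mx; exact: measurable_trmx.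
Qed.

Lemma measurable_lsubmx m n1 n2 :
  measurable_fun setT (@lsubmx R m n1 n2).
Proof.
apply/measurable_mxP => i j; under eq_fun do rewrite mxE.
exact: measurable_entry.
Qed.

Lemma measurable_rsubmx m n1 n2 :
  measurable_fun setT (@rsubmx R m n1 n2).
Proof.
apply/measurable_mxP => i j; under eq_fun do rewrite mxE.
exact: measurable_entry.
Qed.

(** The first row becomes the inner variable, to be integrated with the other rows frozen. The map
    [f] only rearranges coordinates, so it is an isometry. *)
Lemma integral_gauss_col_mx m n (F : 'M[R]_(m.+1, n) -> \bar R) :
  measurable_fun setT F -> (forall X, 0 <= F X)%E ->
  (\int[gauss R (m.+1 * n)]_r F (vec_mx r) =
   \int[gauss R (m * n)]_h \int[gauss R n]_g F (col_mx g (vec_mx h)))%E.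
Proof.
move=> mF F0.
pose f (r : 'rV[R]_(n + m * n)) : 'rV[R]_(m.+1 * n) :=
  mxvec (col_mx (lsubmx r) (vec_mx (rsubmx r)) : 'M[R]_(m.+1, n)).
have mc : measurable_fun setT (fun z : 'rV[R]_n * 'rV[R]_(m * n) =>
    F (col_mx z.1 (vec_mx z.2))).
  apply: (measurableT_comp mF); apply: (@measurable_col_mx _ _ 1 m n).
    exact: measurable_fst.
  by apply: measurable_vec_mx; exact: measurable_snd.
rewrite -(@integral_gauss_linear_isometry (m.+1 * n) f (fun r => F (vec_mx r)))//; first last.
- by apply: (measurableT_comp mF); exact: measurable_vec_mx.
- move=> v; rewrite /f sqnorm_mxvec (@big_split_ord _ _ _ 1 m) big_ord1/=.
  rewrite -[in RHS](@hsubmxK _ 1 n (m * n) v) (@sqnorm_row_mx n (m * n)); congr (_ + _).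
    by apply: eq_bigr => j _; rewrite (@col_mxEu _ 1 m n).
  rewrite -[in RHS](vec_mxK (rsubmx _)) sqnorm_mxvec.
  by apply: eq_bigr => i _; apply: eq_bigr => j _; rewrite (@col_mxEd _ 1 m n).
- move=> a u v; rewrite /f !linearP.
  by rewrite -(@add_col_mx _ 1 m n) -(@scale_col_mx _ 1 m n) linearP.
have mfr : measurable_fun setT (fun r => F (vec_mx (f r))).
  rewrite /f; under eq_fun do rewrite mxvecK.
  apply: (measurableT_comp mF); apply: (@measurable_col_mx _ _ 1 m n).
    exact: measurable_lsubmx.
  by apply: measurable_vec_mx; exact: measurable_rsubmx.
rewrite (@integral_gaussD R n (m * n) (fun r => F (vec_mx (f r))))//.
have fE (z : 'rV[R]_n * 'rV[R]_(m * n)) :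
    F (vec_mx (f (row_mx z.1 z.2))) = F (col_mx z.1 (vec_mx z.2)).
  by rewrite /f mxvecK row_mxKl row_mxKr.
rewrite (fubini_tonelli (m1 := gauss R n) (m2 := gauss R (m * n)) (fun z : 'rV[R]_n * 'rV[R]_(m * n) =>
    F (vec_mx (f (row_mx z.1 z.2)))))/=; first last.
- by move=> z.
- by under eq_fun do rewrite fE.
by apply: eq_integral => h _; apply: eq_integral => g _; rewrite (fE (g, h)).
Qed.

End gaussian_invariance.

(** * The smallest singular value of a Gaussian matrix *)

Section smallest_singular_value.
Context (R : realType).

(** With z = u W^-1, the first entry of z is q / rho, and H B = 0 leaves z G B = (q / rho) g B.
    Hence q >= |z G|^2 >= |z G B|^2 = (q / rho)^2 |g B|^2. *)
Lemma inv_form_col_mx m d (delta rho : R) (g : 'rV[R]_(m + d)) (H : 'M[R]_(m, m + d))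
    (B : 'M[R]_(m + d, d)) : 0 < delta -> 0 < rho ->
  B^T *m B = 1%:M -> H *m B = 0 ->
  sqnorm (g *m B) / rho ^+ 2 <=
  (inv_form delta (col_mx g H : 'M[R]_(m.+1, m + d)) (consmx rho 0))^-1.
Proof.
move=> d0 r0 BB HB; set q := inv_form _ _ _.
pose G : 'M[R]_(m.+1, m + d) := col_mx g H.
pose u : 'rV[R]_m.+1 := consmx rho 0.
have u0 : u != 0.
  by apply/eqP => /(congr1 (fun w : 'rV[R]_m.+1 => w 0 ord0)); rewrite consmx0 mxE; apply/eqP; rewrite gt_eqF.
have q0 : 0 < q := inv_form_gt0 d0 G u0.
have trE (w : 'rV[R]_m.+1) j : w^T j 0 = w 0 j by rewrite [LHS]mxE.
pose z := u *m invmx (reg_gram delta G).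
have qz : q = z 0 ord0 * rho.
  rewrite /q /inv_form -/G -/u -/z mxE big_ord_recl trE consmx0 big1 ?addr0//.
  by move=> j _; rewrite trE consmxS [X in _ * X]mxE mulr0.
have qE : q = sqnorm (z *m G) + delta * sqnorm z.
  by rewrite -reg_gram_form /q inv_formE.
have zG : z *m G = z 0 ord0 *: g + rsubmx (z : 'rV[R]_(1 + m)) *m H.
  rewrite -[z in LHS](@hsubmxK _ 1 1 m) /G (@mul_row_col _ 1 1 m).
  congr (_ + _); rewrite [lsubmx _]mx11_scalar mul_scalar_mx.
  congr (_ *: _); rewrite [LHS]mxE.
  by apply: (congr1 (z 0)); exact/val_inj.
have zGB : z *m G *m B = z 0 ord0 *: (g *m B).
  by rewrite zG mulmxDl -mulmxA HB mulmx0 addr0 -scalemxAl.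
have z0 : z 0 ord0 = q / rho by rewrite qz mulfK// gt_eqF.
have : q ^+ 2 / rho ^+ 2 * sqnorm (g *m B) <= q.
  rewrite [leRHS]qE -expr_div_n -z0 -sqnormZ -zGB.
  apply: le_trans (sqnorm_mulmx_le _ BB) _.
  by rewrite lerDl mulr_ge0 ?sqnorm_ge0// ltW.
have -> : sqnorm (g *m B) / rho ^+ 2 = (q ^+ 2 / rho ^+ 2 * sqnorm (g *m B)) / q ^+ 2.
  by field; rewrite !gt_eqF.
have -> : q^-1 = q / q ^+ 2 by field; rewrite gt_eqF.
by apply: ler_wpM2r; rewrite invr_ge0 sqr_ge0.
Qed.

Lemma measurable_inv_form d (T : measurableType d) m n (delta : R)
    (G : T -> 'M[R]_(m, n)) (u : T -> 'rV[R]_m) : 0 < delta ->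
  measurable_fun setT G -> measurable_fun setT u ->
  measurable_fun setT (fun t => inv_form delta (G t) (u t)).
Proof.
move=> d0 mG mu.
have mW : measurable_fun setT (fun t => reg_gram delta (G t)).
  apply: measurable_addmx => //; apply: measurable_mulmx => //.
  exact: measurable_trmx.
have mI : measurable_fun setT (fun t => invmx (reg_gram delta (G t))).
  rewrite (_ : (fun t => _) = fun t =>
      (\det (reg_gram delta (G t)))^-1 *: \adj (reg_gram delta (G t))).
    apply/measurable_mxP => i j; under eq_fun do rewrite mxE.
    apply: measurable_funM.
      by apply: measurable_invr; exact: measurable_determinant.
    by have /measurable_mxP/(_ i j) := measurable_adjugate mW.
  by apply/funext => t; rewrite /invmx reg_gram_unit.
have : measurable_fun setT (fun t => u t *m invmx (reg_gram delta (G t)) *m (u t)^T).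
  by apply: measurable_mulmx; [exact: measurable_mulmx|exact: measurable_trmx].
by move=> /measurable_mxP/(_ 0 0).
Qed.

Section fixed_direction.
Variables (m d : nat) (kappa delta : R).
Hypotheses (kappa0 : 0 < kappa) (delta0 : 0 < delta).
Local Notation M := m.+1.
Local Notation n := (m + d)%N.

Let F (u : 'rV[R]_M) (X : 'M[R]_(M, n)) : \bar R := (psi kappa (inv_form delta X u))%:E.

Let mF d' (T : measurableType d') (X : T -> 'M[R]_(M, n)) (u : T -> 'rV[R]_M) :
  measurable_fun setT X -> measurable_fun setT u ->
  measurable_fun setT (fun t => F (u t) (X t)).
Proof.
move=> mX mu; apply/measurable_EFinP; apply: measurable_psi.
exact: measurable_inv_form.
Qed.

Lemma gauss_inv_form_le (u : 'rV[R]_M) :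
  (\int[gauss R (M * n)]_r (psi kappa (inv_form delta (vec_mx r : 'M[R]_(M, n)) u))%:E <=
   ((Num.sqrt (sqnorm u) / Num.sqrt (2 * kappa)) ^+ d)%:E)%E.
Proof.
have [->|u0] := eqVneq u 0.
  rewrite integral0_eq => [|r _].
    by rewrite lee_fin exprn_ge0// divr_ge0// sqrtr_ge0.
  rewrite /inv_form !mul0mx mxE /psi ltxx//.
have [Q [QT QQ uQ]] := householder u.
set rho := Num.sqrt (sqnorm u) in uQ *.
have rho0 : 0 < rho by rewrite sqrtr_gt0 sqnorm_gt0.
have FQ (X : 'M[R]_(M, n)) : F u (Q *m X) = F (consmx rho 0) X.
  by rewrite /F inv_form_isometry// uQ.
rewrite -(@integral_gauss_orthogonal R M n Q (F u))//; last 3 first.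
- by rewrite QT.
- exact: mF.
- by move=> X; rewrite lee_fin psi_ge0.
under eq_integral do rewrite FQ.
rewrite (@integral_gauss_col_mx R m n (F (consmx rho 0)))//; last 2 first.
- exact: mF.
- by move=> X; rewrite lee_fin psi_ge0.
apply: (@le_trans _ _ (\int[gauss R (m * n)]_h ((rho / Num.sqrt (2 * kappa)) ^+ d)%:E)%E); last first.
  by rewrite integral_cst//= probability_setT mule1.
have mc : measurable_fun setT (fun z : 'rV[R]_n * 'rV[R]_(m * n) =>
    F (consmx rho 0) (col_mx z.1 (vec_mx z.2))).
  apply: mF => //; apply: (@measurable_col_mx _ _ _ 1 m n).
    exact: measurable_fst.
  by apply: measurable_vec_mx; exact: measurable_snd.
apply: ge0_le_integral => //.
- by move=> h _; apply: integral_ge0 => g _; rewrite lee_fin psi_ge0.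
- apply: (measurable_fun_fubini_tonelli_G (m1 := gauss R n) (fun z : 'rV[R]_n * 'rV[R]_(m * n) =>
    F (consmx rho 0) (col_mx z.1 (vec_mx z.2)))) => //.
  by move=> z; rewrite lee_fin psi_ge0.
move=> h _.
have [B [BB HB]] := exists_orthonormal_kernel (vec_mx h : 'M[R]_(m, m + d)).
pose k := kappa / rho ^+ 2.
have k0 : 0 < k by rewrite divr_gt0// exprn_gt0.
apply: (@le_trans _ _ (\int[gauss R n]_g (expR (- (k * sqnorm (g *m B))))%:E)%E).
  apply: ge0_le_integral => //.
  - by move=> g _; rewrite lee_fin psi_ge0.
  - by apply: mF => //; apply: (@measurable_col_mx _ _ _ 1 m n).
  - apply/measurable_EFinP; apply: measurableT_comp => //.
    apply: measurableT_comp => //; apply: measurable_funM => //.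
    by apply: measurable_sqnorm; exact: measurable_mulmx.
  - move=> g _; rewrite lee_fin /psi; case: ifPn => [q0|_]; last exact: expR_ge0.
    rewrite ler_expR lerN2 /k -mulrA ler_pM2l// mulrC.
    exact: inv_form_col_mx.
rewrite gauss_exp_sub ?(ltW k0)// lee_fin.
apply: lerXn2r; rewrite ?nnegrE ?invr_ge0 ?sqrtr_ge0//.
  by rewrite divr_ge0// ?sqrtr_ge0// ltW.
have k2 : 0 < Num.sqrt (2 * kappa) by rewrite sqrtr_gt0 mulr_gt0.
rewrite -[leRHS]invf_div lef_pV2 ?posrE ?divr_gt0// ?sqrtr_gt0; last by lra.
have -> : Num.sqrt (2 * kappa) / rho = Num.sqrt (2 * k).
  rewrite /k mulrA [RHS]sqrtrM; last by rewrite mulr_ge0// ltW.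
  by rewrite sqrtrV ?sqr_ge0// sqrtr_sqr gtr0_norm.
by rewrite ler_wsqrtr//; lra.
Qed.

End fixed_direction.

Section tail.
Variables (m d : nat) (s : R).
Hypotheses (d0 : (0 < d)%N) (s0 : 0 < s).
Local Notation M := m.+1.
Local Notation n := (m + d)%N.
Variable E : set 'rV[R]_(M * n).
Hypothesis mE : measurable E.
Hypothesis Es : forall r, E r -> exists2 v : 'rV[R]_M, sqnorm v = 1 &
  sqnorm (v *m (vec_mx r : 'M[R]_(M, n))) <= s ^+ 2.

Let tail_reg (delta : R) : 0 < delta ->
  (gauss R (M * n) E <=
   (2 * (expR 1 * Num.sqrt n%:R * Num.sqrt (s ^+ 2 + delta) / d%:R) ^+ d)%:E)%E.
Proof.
move=> delta0.
set w := s ^+ 2 + delta.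
have w0 : 0 < w by rewrite ltr_wpDl// sqr_ge0.
(* Minimizes the resulting bound 2 e^t (sqrt n sqrt w / t)^d. *)
pose t : R := d%:R.
have t0 : 0 < t by rewrite ltr0n.
(* Chosen so that kappa / (y^2 / w) = t^2 / (2 y^2), the exponent in [normal_psi_ge]. *)
pose kappa := t ^+ 2 / (2 * w).
have kappa0 : 0 < kappa by rewrite divr_gt0 ?exprn_gt0 ?mulr_gt0.
pose F (z : 'rV[R]_(M * n) * 'rV[R]_M) : \bar R :=
  (psi kappa (inv_form delta (vec_mx z.1 : 'M[R]_(M, n)) z.2))%:E.
have F0 z : (0 <= F z)%E by rewrite lee_fin psi_ge0.
have mF : measurable_fun setT F.
  apply/measurable_EFinP; apply: measurable_psi; apply: measurable_inv_form => //.
  by apply: measurable_vec_mx; exact: measurable_fst.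
have lower : ((expR (- t) / 2)%:E * gauss R (M * n) E <=
    \int[gauss R (M * n)]_r \int[gauss R M]_u F (r, u))%E.
  have -> : gauss R (M * n) E = (\int[gauss R (M * n)]_r (\1_E r)%:E)%E.
    by rewrite integral_indic// setIT.
  have m1 : measurable_fun setT (fun r : 'rV[R]_(M * n) => (\1_E r)%:E : \bar R).
    by apply/measurable_EFinP; exact: measurable_indic.
  rewrite -ge0_integralZl_EFin//.
  apply: ge0_le_integral => //.
  - exact: emeasurable_funM.
  - exact: measurable_fun_fubini_tonelli_F.
  - move=> r _; rewrite indicE; case: (boolP (r \in E)) => [|_]; last first.
      by rewrite mule0; exact: integral_ge0.
    rewrite inE mule1 => /Es[v v1 vr].
    apply: (le_trans (normal_psi_ge t0)).
    rewrite -(@integral_gauss_dot R M v (fun x => (psi (t ^+ 2 / 2) (x ^+ 2))%:E))//; last 2 first.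
    - by apply/measurable_EFinP; apply: measurable_psi; exact: measurable_funX.
    - by move=> x; rewrite lee_fin psi_ge0.
    have muv : measurable_fun setT (fun u : 'rV[R]_M => (u *m v^T) 0 0).
      have : measurable_fun setT (fun u : 'rV[R]_M => u *m v^T) by exact: measurable_mulmx.
      by move=> /measurable_mxP/(_ 0 0).
    apply: ge0_le_integral => //.
    - by move=> u _; rewrite lee_fin psi_ge0.
    - by apply/measurable_EFinP; apply: measurable_psi; exact: measurable_funX.
    - by apply: (measurableT_comp mF); exact: measurable_fun_pair.
    - move=> u _; rewrite lee_fin.
      have -> : psi (t ^+ 2 / 2) ((u *m v^T) 0 0 ^+ 2) = psi kappa ((u *m v^T) 0 0 ^+ 2 / w).
        move: ((u *m v^T) 0 0) => y.
        have yE : (0 < y ^+ 2 / w) = (0 < y ^+ 2) by rewrite pmulr_lgt0 ?invr_gt0.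
        rewrite /psi yE; case: (ltP 0 (y ^+ 2)) => // p0.
        have y0 : y != 0 by rewrite -sqrf_eq0 gt_eqF.
        by congr (expR (- _)); rewrite /kappa; field; rewrite ?y0 ?gt_eqF.
      apply: le_psi; first exact: ltW.
      apply: inv_form_ge => //.
      by rewrite v1 mulr1 lerD2r.
have upper : (\int[gauss R (M * n)]_r \int[gauss R M]_u F (r, u) <=
    ((Num.sqrt n%:R / Num.sqrt (2 * kappa)) ^+ d)%:E)%E.
  rewrite (fubini_tonelli (m1 := gauss R (M * n)) (m2 := gauss R M) F)//.
  have k20 : 0 < Num.sqrt (2 * kappa) by rewrite sqrtr_gt0 mulr_gt0.
  have mn : measurable_fun setT (fun u : 'rV[R]_M => (Num.sqrt (sqnorm u) ^+ d)%:E).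
    apply/measurable_EFinP; apply: measurable_funX.
    exact: measurable_sqrtr (@measurable_sqnormT R M).
  apply: (@le_trans _ _ (\int[gauss R M]_u
      (((Num.sqrt (2 * kappa))^-1 ^+ d)%:E * (Num.sqrt (sqnorm u) ^+ d)%:E))%E).
    apply: ge0_le_integral => //.
    - by move=> u _; exact: integral_ge0.
    - exact: measurable_fun_fubini_tonelli_G.
    - exact: emeasurable_funM.
    - move=> u _; apply: le_trans (gauss_inv_form_le d kappa0 delta0 u) _.
      by rewrite -EFinM lee_fin -exprMn mulrC.
  rewrite ge0_integralZl_EFin//.
  have := @gauss_norm_moment R M d isT.
  have -> : (M + d - 1 = n)%N by rewrite addSn subn1.
  move=> h; apply: (@le_trans _ _ (((Num.sqrt (2 * kappa))^-1 ^+ d)%:E * (Num.sqrt n%:R ^+ d)%:E)%E).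
    by rewrite lee_pmul2l ?lte_fin ?exprn_gt0 ?invr_gt0.
  by rewrite -EFinM -exprMn lee_fin mulrC.
have := le_trans lower upper.
have -> : Num.sqrt (2 * kappa) = t / Num.sqrt w.
  rewrite /kappa (_ : 2 * (t ^+ 2 / (2 * w)) = t ^+ 2 * w^-1); last by field; rewrite gt_eqF.
  by rewrite sqrtrM ?sqr_ge0// sqrtr_sqr gtr0_norm// sqrtrV// ltW.
rewrite muleC -lee_pdivlMr; last by rewrite divr_gt0// expR_gt0.
move/le_trans; apply.
rewrite -EFinM lee_fin le_eqVlt; apply/orP; left; apply/eqP.
have sw : Num.sqrt w != 0 by rewrite gt_eqF// sqrtr_gt0.
rewrite expRN; have -> : expR t = expR 1 ^+ d by rewrite -expRM_natl mulr1.
have e0 : expR 1 ^+ d != 0 :> R by rewrite expf_neq0// gt_eqF ?expR_gt0.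
set Y := (_ / (t / _)) ^+ d.
have -> : Y / ((expR 1 ^+ d)^-1 / 2) = 2 * (expR 1 ^+ d * Y) by field.
rewrite /Y.
by rewrite -exprMn; congr (_ * _ ^+ _); rewrite /t; field; rewrite sw gt_eqF.
Qed.

Lemma gauss_smallest_singular_value :
  (gauss R (M * n) E <= (2 * (expR 1 * Num.sqrt n%:R * s / d%:R) ^+ d)%:E)%E.
Proof.
set C := (X in (_ <= X%:E)%E).
have n0 : 0 < Num.sqrt (n%:R : R) by rewrite sqrtr_gt0 ltr0n addn_gt0 d0 orbT.
have C0 : 0 < C by rewrite mulr_gt0// exprn_gt0// !mulr_gt0 ?expR_gt0// invr_gt0 ltr0n.
have pf : gauss R (M * n) E \is a fin_num by exact: fin_num_measure.
rewrite -(fineK pf) lee_fin leNgt; apply/negP => pC.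
set p := fine _ in pC.
(* If p > C, take [delta] with sqrt (s^2 + delta) = s e^theta, where e^(d theta) = sqrt (p / C). The
   regularized bound becomes p / C <= sqrt (p / C), against p / C > 1. *)
pose theta := ln (p / C) / (2 * d%:R).
have pC1 : 1 < p / C by rewrite ltr_pdivlMr// mul1r.
have th0 : 0 < theta by rewrite divr_gt0 ?ln_gt0// mulr_gt0// ltr0n.
pose delta := s ^+ 2 * (expR theta ^+ 2 - 1).
have delta0 : 0 < delta.
  rewrite mulr_gt0 ?exprn_gt0// subr_gt0 exprn_egt1// -expR0 ltr_expR//.
have := tail_reg delta0.
rewrite -(fineK pf) lee_fin -/p.
have -> : Num.sqrt (s ^+ 2 + delta) = s * expR theta.
  rewrite /delta mulrBr mulr1 addrC subrK sqrtrM ?sqr_ge0// !sqrtr_sqr !gtr0_norm ?expR_gt0//.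
have -> : 2 * (expR 1 * Num.sqrt n%:R * (s * expR theta) / d%:R) ^+ d = C * expR theta ^+ d.
  rewrite /C -[RHS]mulrA -exprMn; congr (_ * _ ^+ _); ring.
rewrite -expRM_natl /theta.
have -> : d%:R * (ln (p / C) / (2 * d%:R)) = ln (p / C) / 2.
  by field; rewrite pnatr_eq0 -lt0n d0.
move=> h.
have pC0 : 0 < p / C by rewrite (lt_trans ltr01).
have : p / C <= expR (ln (p / C) / 2) by rewrite ler_pdivrMr// mulrC.
rewrite -{1}(lnK pC0) ler_expR.
have := ln_gt0 pC1; lra.
Qed.

End tail.
End smallest_singular_value.

(** * The least eigenvalue of a Gram matrix *)

Section least_eigenvalue.
Context (R : realType).

Lemma continuous_sqnorm_mulmx m n (H : 'M[R]_(m, n)) :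
  continuous (fun v : 'rV[R]_m => sqnorm (v *m H)).
Proof.
have cont_sum (I : Type) (r : seq I) (f : I -> 'rV[R]_m -> R) :
    (forall i, continuous (f i)) -> continuous (fun v => \sum_(i <- r) f i v).
  move=> cf; elim: r => [|i r IH].
    rewrite (_ : (fun v => _) = fun=> 0); first exact: cst_continuous.
    by apply/funext => v; rewrite big_nil.
  rewrite (_ : (fun v => _) = fun v => f i v + \sum_(j <- r) f j v).
    by move=> v; exact: (cvgD (cf i v) (IH v)).
  by apply/funext => v; rewrite big_cons.
apply: (cont_sum _ _ (fun j v => (v *m H) 0 j ^+ 2)) => j.
have c : continuous (fun v : 'rV[R]_m => (v *m H) 0 j).
  rewrite (_ : (fun v => _) = fun v : 'rV[R]_m => \sum_i v 0 i * H i j).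
    apply: cont_sum => i w.
    exact: (cvgM (@coord_continuous R 1 m 0 i w) (cvg_cst _)).
  by apply/funext => v; rewrite mxE.
by move=> v; exact: (cvgM (c v) (c v)).
Qed.

Lemma exists_min_rayleigh m n (H : 'M[R]_(m.+1, n)) : exists c : 'rV[R]_m.+1,
  sqnorm c = 1 /\ forall v, sqnorm (c *m H) * sqnorm v <= sqnorm (v *m H).
Proof.
pose A : set 'rV[R]_m.+1 := [set v | sqnorm v = 1].
have cid : continuous (@sqnorm R m.+1).
  rewrite (_ : @sqnorm R m.+1 = fun v => sqnorm (v *m 1%:M)).
    exact: continuous_sqnorm_mulmx.
  by apply/funext => v; rewrite mulmx1.
have A0 : A !=set0.
  exists (consmx 1 0); rewrite /A /= sqnorm_cons expr1n /sqnorm big1 ?addr0//.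
  by move=> j _; rewrite mxE expr0n.
have Acompact : compact A.
  apply: bounded_closed_compact.
    exists 1; split; first exact: num_real.
    move=> y y1 v /= v1; apply: le_trans (ltW y1).
    rewrite [leLHS]/Num.norm /= mx_normrE; apply/bigmax_leP; split => //= -[i j] _ /=.
    rewrite ord1 -(@expr_le1 _ 2)//= real_normK ?num_real//.
    rewrite -v1 /sqnorm (bigD1 j)//= lerDl.
    by apply: sumr_ge0 => k _; exact: sqr_ge0.
  rewrite (_ : A = (@sqnorm R m.+1) @^-1` [set x | x = 1])//.
  apply: preimage_closed => //; exact: closed_eq.
have [c cA cmin] := EVT_min_rV A0 Acompact (continuous_subspaceT (@continuous_sqnorm_mulmx _ _ H)).
move: cA; rewrite inE /A /= => c1; exists c; split => // v.
have [->|v0] := eqVneq v 0.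
  have s0 k : sqnorm (0 : 'rV[R]_k) = 0.
    by rewrite /sqnorm big1// => j _; rewrite mxE expr0n.
  by rewrite mul0mx !s0 mulr0.
have sv := sqnorm_gt0 v0.
have := cmin ((Num.sqrt (sqnorm v))^-1 *: v).
rewrite -scalemxAl inE /A /= !sqnormZ exprVn sqr_sqrtr ?(ltW sv)// mulVf ?(gt_eqF sv)//.
move=> /(_ erefl); rewrite mulrC.
by rewrite ler_pdivlMr.
Qed.

(** The minimum [mu] of the Rayleigh quotient is an eigenvalue: A = H H^T - mu is positive
    semidefinite and its form vanishes at the minimizer [u], which forces u A = 0. Every eigenvalue
    is a Rayleigh quotient, so [mu] is the least one. *)
Lemma lambda_min_gram_lt m n (H : 'M[R]_(m.+1, n)) (c : R) :
  lambda_min (H *m H^T) < c <-> exists v : 'rV[R]_m.+1, sqnorm (v *m H) < c * sqnorm v.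
Proof.
have [u [u1 umin]] := exists_min_rayleigh H.
set mu := sqnorm (u *m H) in umin.
pose A := H *m H^T - mu%:M.
have AT : A^T = A by rewrite /A linearB/= trmx_mul trmxK tr_scalar_mx.
have formA v : (v *m A *m v^T) 0 0 = sqnorm (v *m H) - mu * sqnorm v.
  rewrite /A mulmxBr mulmxBl mxE [X in _ + X]mxE; congr (_ - _).
    by rewrite sqnormE trmx_mul !mulmxA.
  by rewrite mul_mx_scalar -scalemxAl mxE -sqnormE.
have sym (x y : 'rV[R]_m.+1) : (x *m A *m y^T) 0 0 = (y *m A *m x^T) 0 0.
  have -> : x *m A *m y^T = (y *m A *m x^T)^T by rewrite !trmx_mul trmxK AT mulmxA.
  by rewrite mxE.
have uA : u *m A = 0.
  pose w := u *m A; apply: sqnorm0_eq0; rewrite -/w.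
  pose a := sqnorm w; pose b := (w *m A *m w^T) 0 0.
  have a0 : 0 <= a := sqnorm_ge0 w.
  have b0 : 0 <= b by rewrite /b formA subr_ge0.
  have uu : (u *m A *m u^T) 0 0 = 0 by rewrite formA u1 mulr1 subrr.
  have uw : (u *m A *m w^T) 0 0 = a by rewrite /a sqnormE.
  have wu : (w *m A *m u^T) 0 0 = a.
    by rewrite sym.
  have quad e : 0 <= - (2 * e * a) + e ^+ 2 * b.
    have -> : - (2 * e * a) + e ^+ 2 * b = ((u - e *: w) *m A *m (u - e *: w)^T) 0 0.
      rewrite [(_ - _)^T]linearB/= [(_ *: _)^T]linearZ/=.
      rewrite mulmxBr 2!mulmxBl -!scalemxAl -!scalemxAr.
      rewrite mulmxBl -!scalemxAl.
      have := uu; have := uw; have := wu; have : (w *m A *m w^T) 0 0 = b by [].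
      move: (u *m A *m u^T) (u *m A *m w^T) (w *m A *m u^T) (w *m A *m w^T).
      move=> A1 A2 A3 A4 A4p A3p A2p A1p.
      by rewrite !mxE A4p A3p A2p A1p; ring.
    by rewrite formA subr_ge0.
  apply/eqP; rewrite -/a eq_le a0 andbT leNgt; apply/negP => ap.
  (* A small step from [u] along - w would make the form negative if a > 0; the 1 in the denominator
     allows b = 0. *)
  have := quad (a / (b + 1)).
  have -> : - (2 * (a / (b + 1)) * a) + (a / (b + 1)) ^+ 2 * b =
      - (a ^+ 2 * (b + 2)) / (b + 1) ^+ 2.
    by field; rewrite gt_eqF// ltr_wpDl.
  apply/negP; rewrite -ltNge mulNr oppr_lt0 divr_gt0 ?exprn_gt0 ?mulr_gt0 ?exprn_gt0//; lra.
have u0 : u != 0.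
  apply/eqP => u0; move: u1; rewrite u0 /sqnorm big1 => [/eqP|j _].
    by rewrite eq_sym oner_eq0.
  by rewrite mxE expr0n.
have evmu : eigenvalue (H *m H^T) mu.
  apply/eigenvalueP; exists u => //; apply/eqP.
  by rewrite -subr_eq0 -mul_mx_scalar -mulmxBr -/A uA.
have lb : lbound [set a : R | eigenvalue (H *m H^T) a] mu.
  move=> a /= /eigenvalueP[v va v0].
  have vH : sqnorm (v *m H) = a * sqnorm v.
    by rewrite sqnormE trmx_mul mulmxA -(mulmxA v) va -scalemxAl mxE -sqnormE.
  by have := umin v; rewrite vH ler_pM2r// sqnorm_gt0.
have lE : lambda_min (H *m H^T) = mu.
  apply/eqP; rewrite eq_le; apply/andP; split.
    by apply: ge_inf => //; exists mu.
  by apply: lb_le_inf => //; exists mu.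
rewrite lE; split => [muc|[v vc]].
  by exists u; rewrite u1 mulr1.
have v0 : v != 0.
  apply/eqP => v0; move: vc; rewrite v0 mul0mx /sqnorm !big1 ?mulr0 ?ltxx// => j _.
    by rewrite mxE expr0n.
  by rewrite mxE expr0n.
by have := le_lt_trans (umin v) vc; rewrite ltr_pM2r// sqnorm_gt0.
Qed.

Definition contracting m n (c : R) (H : 'M[R]_(m, n)) :=
  exists v : 'rV[R]_m, sqnorm (v *m H) < c * sqnorm v.

(** The inequality is strict, hence open in [v], so rational vectors suffice and the event becomes a
    countable union. *)
Lemma contracting_rat m n c (H : 'M[R]_(m, n)) : contracting c H <->
  exists q : 'rV[rat]_m, sqnorm (map_mx ratr q *m H) < c * sqnorm (map_mx ratr q : 'rV[R]_m).
Proof.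
split=> [[v vc]|[q qc]]; last by exists (map_mx ratr q).
pose f (w : 'rV[R]_m) := c * sqnorm w - sqnorm (w *m H).
have cf : continuous f.
  have cs : continuous (@sqnorm R m).
    rewrite (_ : @sqnorm R m = fun v => sqnorm (v *m 1%:M)).
      exact: continuous_sqnorm_mulmx.
    by apply/funext => y; rewrite mulmx1.
  move=> w; apply: (@continuousB R R^o _ (fun w => c * sqnorm w) _ w).
    by apply: (@continuousM R _ (fun=> c) _ w); [exact: cst_continuous|exact: cs].
  exact: continuous_sqnorm_mulmx.
have fv : 0 < f v by rewrite subr_gt0.
have := cf v _ (lt_nbhsr fv).
move=> /nbhs_ballP[e /= e0 be].
have qe i : exists q : rat, `|v 0 i - ratr q| < e.
  have : v 0 i - e < v 0 i + e by lra.
  move=> /rat_in_itvoo[q]; rewrite in_itv/= => /andP[q1 q2].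
  by exists q; rewrite ltr_distl; apply/andP; split; lra.
have [q hq] := choice qe.
exists (\row_i q i); rewrite -subr_gt0; apply: be.
split => // i j; rewrite ord1 !mxE; exact: hq.
Qed.

Lemma measurable_contracting d (T : measurableType d) m n c (H : T -> 'M[R]_(m, n)) :
  measurable_fun setT H -> measurable [set t | contracting c (H t)].
Proof.
move=> mH.
rewrite (_ : [set t | _] = \bigcup_(q in [set: 'rV[rat]_m])
  [set t | sqnorm (map_mx ratr q *m H t) < c * sqnorm (map_mx ratr q : 'rV[R]_m)]).
  apply: countable_bigcupT_measurable => // q.
  rewrite -[X in measurable X]setTI.
  have mf : measurable_fun setT (fun t => sqnorm (map_mx ratr q *m H t)).
    by apply: measurable_sqnorm; exact: measurable_mulmx.
  exact: (measurable_fun_ltr mf (measurable_cst _) measurableT (Y := [set true])).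
apply/seteqP; split => t /=; first by move=> /contracting_rat[q qc]; exists q.
by move=> [q _ qc]; apply/contracting_rat; exists q.
Qed.

End least_eigenvalue.

(** * Optimization of the product of the two tails *)

Section power_bounds.
Context (R : realType).

Lemma exprn_le_expR (y : R) a : 0 <= y -> y ^+ a <= expR (a%:R * (y - 1)).
Proof.
move=> y0; rewrite expRM_natl; apply: lerXn2r; rewrite ?nnegrE ?expR_ge0//.
by have := expR_ge1Dx (y - 1); rewrite addrC subrK.
Qed.

(* Two uses of y <= exp (y - 1), with y = (a + m) x / (a N) and y = x / (2 a). *)
Lemma rate_factor_le (m a x N : nat) : (0 < x)%N -> (0 < N)%N ->
  ((m + a)%:R / a%:R ^+ 2) ^+ a <= (2 * N%:R / x%:R ^+ 2) ^+ a *
    expR ((a + m)%:R * x%:R / N%:R + x%:R / 2 - 2 * a%:R) :> R.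
Proof.
move=> x0 N0.
have xp : 0 < x%:R :> R by rewrite ltr0n.
have Np : 0 < N%:R :> R by rewrite ltr0n.
have [->|a0] := posnP a.
  rewrite !expr0 mul1r add0n mulr0 subr0 -[leLHS]expR0 ler_expR.
  by rewrite addr_ge0// divr_ge0 ?mulr_ge0// ltW.
have ap : 0 < a%:R :> R by rewrite ltr0n.
pose y1 : R := (a + m)%:R * x%:R / (a%:R * N%:R).
pose y2 : R := x%:R / (2 * a%:R).
have -> : (m + a)%:R / a%:R ^+ 2 = (2 * N%:R / x%:R ^+ 2) * (y1 * y2) :> R.
  by rewrite /y1 /y2 addnC; field; rewrite !gt_eqF.
rewrite exprMn ler_wpM2l//.
have y10 : 0 <= y1 by rewrite divr_ge0// mulr_ge0.
have y20 : 0 <= y2 by rewrite divr_ge0// mulr_ge0.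
rewrite exprMn; apply: le_trans (ler_pM _ _ (exprn_le_expR a y10) (exprn_le_expR a y20)) _.
- exact: exprn_ge0.
- exact: exprn_ge0.
rewrite -expRD ler_expR le_eqVlt; apply/orP; left; apply/eqP.
by rewrite /y1 /y2; field; rewrite !gt_eqF.
Qed.

(** The tail bound for m + 1 rows and m + a columns, without its factor 2; it is 1 at a = 0. *)
Definition rate (m : nat) (s : R) (a : nat) : R :=
  (expR 1 * Num.sqrt (m + a)%:R * s / a%:R) ^+ a.

Lemma rate_ge0 m s a : 0 <= s -> 0 <= rate m s a.
Proof.
by move=> s0; rewrite exprn_ge0// divr_ge0// mulr_ge0// mulr_ge0 ?sqrtr_ge0 ?expR_ge0.
Qed.

(** The right-hand side is the formal value of the product at a = b = x / 2. Squaring removes the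
    roots. *)
Lemma rate_mul_le m s a b : 0 <= s -> (0 < a + b)%N ->
  rate m s a * rate m s b <=
  (expR 1 * Num.sqrt (2 * (a + b + m.*2)%:R) * s / (a + b)%:R) ^+ (a + b).
Proof.
move=> s0 ab0; set x := (a + b)%N; set N := (x + m.*2)%N.
have N0 : (0 < N)%N by rewrite addn_gt0 ab0.
have xp : 0 < x%:R :> R by rewrite ltr0n.
have Np : 0 < N%:R :> R by rewrite ltr0n.
pose c : R := (expR 1 * s) ^+ 2.
have c0 : 0 <= c by exact: sqr_ge0.
have rate2 e : rate m s e ^+ 2 = c ^+ e * ((m + e)%:R / e%:R ^+ 2) ^+ e.
  rewrite /rate exprAC -exprMn; congr (_ ^+ e).
  by rewrite expr_div_n !exprMn sqr_sqrtr// /c exprMn; ring.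
have rhs0 : 0 <= expR 1 * Num.sqrt (2 * N%:R) * s / x%:R.
  by rewrite divr_ge0// mulr_ge0// mulr_ge0 ?sqrtr_ge0 ?expR_ge0.
rewrite -(ler_pXn2r (n := 2))// ?nnegrE ?mulr_ge0 ?rate_ge0 ?exprn_ge0//.
rewrite exprMn !rate2 mulrACA -exprD.
have -> : ((expR 1 * Num.sqrt (2 * N%:R) * s / x%:R) ^+ x) ^+ 2 =
    c ^+ x * (2 * N%:R / x%:R ^+ 2) ^+ x.
  rewrite exprAC -exprMn; congr (_ ^+ x).
  rewrite expr_div_n !exprMn sqr_sqrtr ?mulr_ge0// /c exprMn; ring.
apply: ler_wpM2l; first exact: exprn_ge0.
apply: le_trans (ler_pM _ _ (rate_factor_le m a ab0 N0) (rate_factor_le m b ab0 N0)) _.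
- by rewrite exprn_ge0// divr_ge0 ?exprn_ge0.
- by rewrite exprn_ge0// divr_ge0 ?exprn_ge0.
rewrite mulrACA -exprD -expRD -/x.
(* The two exponents add up to (x + 2m) x / N + x - 2x, which is 0 because N = x + 2m. *)
rewrite [X in expR X](_ : _ = 0) ?expR0 ?mulr1//.
have -> : N%:R = x%:R + 2 * m%:R :> R by rewrite /N natrD -mul2n natrM.
have xab : x%:R = a%:R + b%:R :> R by rewrite natrD.
have : x%:R + 2 * m%:R != 0 :> R by rewrite gt_eqF// ltr_wpDr// mulr_ge0.
rewrite (natrD _ a m) (natrD _ b m) xab => h.
by field.
Qed.

(** The factors x / sqrt N and 1 / (sqrt 2 e) of [sigma] cancel those of the tail and leave the base
    e^(- eta) 2^(- rho). With D = N - 2M one has eta = eps M / D and rho = N / D, so the power x = D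
    + 2 yields at least eps M and N + 2 in the exponents; the latter pays for 2^N and for 4 =
    2^2. *)
Lemma exponent_bound (M N : nat) (eps : R) : (0 < M)%N -> 0 < eps ->
  2 < N%:R / M%:R :> R ->
  let ratio : R := N%:R / M%:R in
  let x : nat := (N - M.*2 + 2)%N in
  let sigma : R := 1 / (Num.sqrt 2 * expR (1 + eps / (ratio - 2))) *
    ((N%:R - 2 * M%:R + 2) / (2 `^ (ratio / (ratio - 2)) * Num.sqrt N%:R)) in
  0 < sigma /\
  2 ^+ N * (4 * (expR 1 * Num.sqrt (2 * N%:R) * sigma / x%:R) ^+ x) <=
  expR (- (eps * M%:R)).
Proof.
move=> M0 e0 R2 ratio x sigma.
have Mp : 0 < M%:R :> R by rewrite ltr0n.
have NM : 2 * M%:R < N%:R :> R by rewrite -ltr_pdivlMr.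
have NMn : (M.*2 < N)%N by rewrite -(ltr_nat R) -mul2n natrM.
have Np : 0 < N%:R :> R by rewrite (le_lt_trans _ NM)// mulr_ge0.
have xE : x%:R = N%:R - 2 * M%:R + 2 :> R.
  by rewrite /x natrD natrB ?(ltnW NMn)// -mul2n natrM.
have xp : 0 < x%:R :> R by rewrite xE; lra.
have sN : 0 < Num.sqrt N%:R :> R by rewrite sqrtr_gt0.
have s2 : 0 < Num.sqrt 2 :> R by rewrite sqrtr_gt0.
have p2 : 0 < 2 `^ (ratio / (ratio - 2)) by rewrite powR_gt0.
have ss : 0 < sigma.
  rewrite /sigma -xE mulr_gt0 ?divr_gt0 ?mulr_gt0 ?expR_gt0//.
split => //.
set eta := eps / (ratio - 2); set rho := ratio / (ratio - 2).
have -> : expR 1 * Num.sqrt (2 * N%:R) * sigma / x%:R = expR (- (eta + rho * ln 2)).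
  have -> : Num.sqrt (2 * N%:R) = Num.sqrt 2 * Num.sqrt N%:R :> R by rewrite sqrtrM.
  rewrite /sigma -/eta -/rho -xE expRN !expRD.
  have -> : 2 `^ rho = expR (rho * ln 2) :> R by rewrite /powR pnatr_eq0.
  by field; rewrite !gt_eqF ?expR_gt0.
rewrite -expRM_natl mulrN.
have -> : 2 ^+ N * (4 * expR (- (x%:R * (eta + rho * ln 2)))) =
    expR ((N%:R + 2) * ln 2 - x%:R * (eta + rho * ln 2)).
  have -> : (N%:R + 2) * ln 2 = (N + 2)%:R * ln 2 :> R by rewrite natrD.
  rewrite expRD expRM_natl lnK ?posrE// exprD mulrA; congr (_ * _ * _).
  by rewrite expr2; ring.
rewrite ler_expR.
pose D : R := N%:R - 2 * M%:R.
have D0 : 0 < D by rewrite subr_gt0.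
have rE : ratio - 2 = D / M%:R by rewrite /ratio /D; field; rewrite gt_eqF.
have h1 : eps * M%:R <= x%:R * eta.
  rewrite /eta rE xE -/D.
  have -> : (D + 2) * (eps / (D / M%:R)) = eps * M%:R * ((D + 2) / D).
    by field; rewrite !gt_eqF.
  by rewrite ler_peMr ?mulr_ge0 ?(ltW e0)// ler_pdivlMr// mul1r lerDl.
have h2 : N%:R + 2 <= x%:R * rho.
  rewrite /rho rE xE -/D /ratio.
  have -> : (D + 2) * (N%:R / M%:R / (D / M%:R)) = N%:R + 2 * (N%:R / D) :> R.
    by field; rewrite !gt_eqF.
  rewrite lerD2l ler_peMr// ler_pdivlMr// mul1r /D.
  by rewrite gerBl mulr_ge0.
have l2 : 0 < ln 2 :> R by rewrite ln_gt0// ltr1n.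
have h3 : (N%:R + 2) * ln 2 <= x%:R * rho * ln 2 by rewrite ler_wpM2r// ltW.
by rewrite mulrDr mulrA; lra.
Qed.

End power_bounds.

(** * Tail bounds for the events used in the union bound *)

Section gaussian_matrix_tail.
Context (R : realType).

Lemma gauss_setX p q (A : set 'rV[R]_p) (B : set 'rV[R]_q) :
  measurable A -> measurable B ->
  (gauss R (p + q) [set r | A (lsubmx r) /\ B (rsubmx r)] =
   gauss R p A * gauss R q B)%E.
Proof.
move=> mA mB; set C := [set r | _].
have mC : measurable C.
  rewrite (_ : C = @lsubmx R 1 p q @^-1` A `&` @rsubmx R 1 p q @^-1` B)//.
  apply: measurableI; rewrite -[X in measurable X]setTI.
    exact: measurable_lsubmx.
  exact: measurable_rsubmx.
have CE u v : (\1_C (row_mx u v) = \1_A u * \1_B v :> R)%R.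
  rewrite !indicE -natrM mulnb; congr (nat_of_bool _)%:R.
  apply/idP/andP; rewrite !inE /C /= row_mxKl row_mxKr.
    by move=> [].
  by move=> [].
have -> : gauss R (p + q) C = (\int[gauss R (p + q)]_r (\1_C r)%:E)%E.
  by rewrite integral_indic// setIT.
rewrite integral_gaussD//; first last.
  by apply/measurable_EFinP; exact: measurable_indic.
have E u : (\int[gauss R q]_v (\1_C (row_mx u v))%:E = gauss R q B * (\1_A u)%:E)%E.
  under eq_integral do rewrite CE EFinM.
  rewrite ge0_integralZl_EFin//; last by apply/measurable_EFinP; exact: measurable_indic.
  by rewrite integral_indic// setIT muleC.
under eq_integral do rewrite E.
rewrite ge0_integralZl//; last by apply/measurable_EFinP; exact: measurable_indic.
by rewrite integral_indic// setIT muleC.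
Qed.

Lemma measurable_contracting_vec m n c :
  measurable [set r : 'rV[R]_(m * n) | contracting c (vec_mx r)].
Proof. by apply: measurable_contracting; exact: measurable_vec_mx. Qed.

Lemma gauss_contracting_le m n a (s : R) : 0 < s -> n = (m + a)%N ->
  (gauss R (m.+1 * n) [set r | contracting (s ^+ 2) (vec_mx r)] <=
   (2 * rate m s a)%:E)%E.
Proof.
move=> s0 ->.
have mB := @measurable_contracting_vec m.+1 (m + a) (s ^+ 2).
have [->|a0] := posnP a.
  rewrite /rate expr0 mulr1; apply: (le_trans (probability_le1 _ _)).
    exact: measurable_contracting_vec.
  by rewrite lee_fin ler1n.
apply: gauss_smallest_singular_value => // r [v vs].
have v0 : v != 0.
  apply/eqP => v0; move: vs; rewrite v0 mul0mx /sqnorm !big1 ?mulr0 ?ltxx// => j _.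
    by rewrite mxE expr0n.
  by rewrite mxE expr0n.
have sv := sqnorm_gt0 v0.
exists ((Num.sqrt (sqnorm v))^-1 *: v).
  by rewrite sqnormZ exprVn sqr_sqrtr ?(ltW sv)// mulVf// gt_eqF.
rewrite -scalemxAl sqnormZ exprVn sqr_sqrtr ?(ltW sv)//.
by rewrite mulrC ler_pdivrMr// ltW.
Qed.

End gaussian_matrix_tail.

(** * Submatrices of a random matrix *)

Section column_subsets.
Context (R : realType) (M N : nat).

Lemma sqnorm_col_submatrix (Phi : 'M[R]_(M, N)) (S : {set 'I_N}) v :
  sqnorm (v *m col_submatrix Phi S) = \sum_(j in S) (v *m Phi) 0 j ^+ 2.
Proof.
rewrite big_enum_val; apply: eq_bigr => k _; congr (_ ^+ 2).
by rewrite !mxE; apply: eq_bigr => i _; rewrite mxE.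
Qed.

Lemma contracting_subset c (Phi : 'M[R]_(M, N)) (S S' : {set 'I_N}) :
  S' \subset S -> contracting c (col_submatrix Phi S) ->
  contracting c (col_submatrix Phi S').
Proof.
move=> S'S [v vS]; exists v; apply: le_lt_trans vS.
rewrite !sqnorm_col_submatrix [leRHS](big_setID S')/= (finset.setIidPr S'S) lerDl.
by apply: sumr_ge0 => j _; exact: sqr_ge0.
Qed.

Lemma exists_subset_card (T : finType) (A : {set T}) k : (k <= #|A|)%N ->
  exists2 B : {set T}, B \subset A & #|B| = k.
Proof.
move=> kA; exists [set x in take k (enum A)].
  by apply/fintype.subsetP => x; rewrite finset.inE => /mem_take; rewrite mem_enum.
rewrite cardsE; have /card_uniqP -> : uniq (take k (enum A)).
  by rewrite take_uniq// enum_uniq.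
by rewrite size_takel// -cardE.
Qed.

End column_subsets.

Section random_columns.
Context (R : realType) d (T : measurableType d) (P : probability T R) (M N : nat).
Context (X : 'I_M * 'I_N -> {RV P >-> R}).
Hypothesis X_normal : forall ij, standard_normal (X ij).
Hypothesis X_indep : mutually_independent X.

Definition gram_event (c : R) (S : {set 'I_N}) : set T :=
  [set w | contracting c (col_submatrix (random_matrix X w) S)].

(** Flattens the submatrix into a row of distinct entries; membership of the column index in [S] is
    recorded to separate the entries of [S] from those of its complement. *)
Lemma exists_entry_indexing (S : {set 'I_N}) :
  exists h : 'I_(M * #|S|) -> 'I_M * 'I_N,
    [/\ injective h, forall k, (h k).2 \in S &
        forall w, vec_mx (random_row X h w) = col_submatrix (random_matrix X w) S].
Proof.
have [g gK Kg'] := curry_mxvec_bij M #|S|.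
have Kg : cancel g (uncurry (@mxvec_index M #|S|)) by move=> k; exact: Kg'.
exists (fun k => ((g k).1, enum_val (g k).2)); split.
- move=> k l [h1 h2]; apply: (can_inj Kg).
  move: h1 (enum_val_inj h2).
  by case: (g k) (g l) => [a b] [a' b'] /= -> ->.
- by move=> k; exact: enum_valP.
- move=> w; apply/matrixP => i j; rewrite !mxE.
  by have /= -> := gK (i, j) isT.
Qed.

Lemma measurable_gram_event c S : measurable (gram_event c S).
Proof.
apply: measurable_contracting; apply/measurable_mxP => i j.
by under eq_fun do rewrite !mxE; exact: measurable_funPT.
Qed.

Lemma gram_event_prob c S :
  P (gram_event c S) = gauss R (M * #|S|) [set r | contracting c (vec_mx r)].
Proof.
have [h [hI _ hE]] := exists_entry_indexing S.
rewrite -(random_row_gauss X_normal X_indep hI); last exact: measurable_contracting_vec.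
by congr (P _); apply/seteqP; split => w; rewrite /gram_event /= hE.
Qed.

(** Disjoint column sets make the concatenated indexing [H] injective, so both submatrices together
    form one Gaussian row, whose law splits by [gauss_setX]. *)
Lemma gram_event_indep (c : R) (S : {set 'I_N}) :
  (P (gram_event c S `&` gram_event c (~: S)%SET) =
   P (gram_event c S) * P (gram_event c (~: S)%SET))%E.
Proof.
set S' := (~: S)%SET; rewrite !gram_event_prob.
have [h [hI hS hE]] := exists_entry_indexing S.
have [h' [hI' hS' hE']] := exists_entry_indexing S'.
pose H (k : 'I_(M * #|S| + M * #|S'|)) :=
  match fintype.split k with inl i => h i | inr i => h' i end.
have hh' i j : h i <> h' j.
  by move=> E; have := hS' j; rewrite -E finset.inE hS.
have HI : injective H.
  move=> k l Hkl; apply: (can_inj (@splitK _ _)); move: Hkl; rewrite /H.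
  case: (fintype.split k) => i; case: (fintype.split l) => j //= E.
  - by rewrite (hI _ _ E).
  - by case: (hh' _ _ E).
  - by case: (hh' _ _ (esym E)).
  - by rewrite (hI' _ _ E).
have HE w : random_row X H w = row_mx (random_row X h w) (random_row X h' w).
  apply/rowP => k; rewrite !mxE /H; by case: fintype.split => i; rewrite mxE.
rewrite -gauss_setX; [|exact: measurable_contracting_vec..].
rewrite -(random_row_gauss X_normal X_indep HI).
  congr (P _); apply/seteqP.
  by split => w /=; rewrite /gram_event /= HE row_mxKl row_mxKr hE hE'.
rewrite (_ : [set r | _] =
  @lsubmx R 1 (M * #|S|) (M * #|S'|) @^-1` [set r | contracting c (vec_mx r)] `&`
  @rsubmx R 1 (M * #|S|) (M * #|S'|) @^-1` [set r | contracting c (vec_mx r)])//.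
apply: measurableI; rewrite -[X in measurable X]setTI.
  by apply: measurable_lsubmx => //; exact: measurable_contracting_vec.
by apply: measurable_rsubmx => //; exact: measurable_contracting_vec.
Qed.

End random_columns.

(** * Union bound over the column sets *)

Lemma measure_bigsetU_le (R : realType) d (T : measurableType d)
    (mu : {measure set T -> \bar R}) (I : eqType) (r : seq I) (A : I -> set T) :
  (forall i, measurable (A i)) ->
  (mu (\big[setU/set0]_(i <- r) A i) <= \sum_(i <- r) mu (A i))%E.
Proof.
move=> mA; elim: r => [|i r IH]; first by rewrite !big_nil measure0.
rewrite !big_cons; apply: le_trans (leeD2l _ IH).
by apply: measureU2 => //; exact: bigsetU_measurable.
Qed.

Theorem theorem20 (R : realType) (d : measure_display) (T : measurableType d)
    (P : probability T R) (M N : nat) (X : 'I_M * 'I_N -> {RV P >-> R})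
    (M_gt0 : (0 < M)%N)
    (X_normal : forall ij, standard_normal (X ij))
    (X_indep : mutually_independent X)
    (ratio_gt2 : 2 < N%:R / M%:R :> R)
    (eps : R) (eps_gt0 : 0 < eps) :
  let ratio : R := N%:R / M%:R in
  let sigma : R :=
    1 / (Num.sqrt 2 * expR (1 + eps / (ratio - 2))) *
    ((N%:R - 2 * M%:R + 2) / (2 `^ (ratio / (ratio - 2)) * Num.sqrt N%:R)) in
  ((1 - expR (- (eps * M%:R)))%:E <=
    P [set w | strong_complement_property sigma (random_matrix X w)])%E.
Proof.
have := exponent_bound M_gt0 eps_gt0 ratio_gt2; cbv zeta.
set sigma := 1 / _ * _ => -[sigma0 bound].
move: sigma sigma0 bound => sigma sigma0 bound.
have NM : (M.*2 < N)%N.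
  rewrite -(ltr_nat R) -mul2n natrM -ltr_pdivlMr ?ltr0n//.
case: M M_gt0 X X_normal X_indep ratio_gt2 bound NM => [//|m] _ X X_normal X_indep _ bound NM.
pose E := gram_event X (sigma ^+ 2).
have mE S : measurable (E S) := measurable_gram_event X _ S.
pose F := \big[setU/set0]_(S : {set 'I_N}) (E S `&` E (~: S)%SET).
have mES S : measurable (E S `&` E (~: S)%SET) by exact: measurableI.
have mF : measurable F by exact: bigsetU_measurable.
(* The maximum is below [sigma ^+ 2] exactly when both least eigenvalues are, so failure at [S] is
   the intersection of two independent events. *)
have -> : [set w | strong_complement_property sigma (random_matrix X w)] = ~` F.
  have FE w : F w <-> exists S, E S w /\ E (~: S)%SET w.
    rewrite /F -bigcup_seq/=; split=> [[S _ ?]|[S ?]]; exists S => //.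
    by rewrite /= mem_index_enum.
  apply/seteqP; split=> w /=.
    move=> scp /FE[S [bS bSc]].
    have := scp S; cbv zeta; rewrite leNgt gt_max => /negP; apply.
    by apply/andP; split; apply/lambda_min_gram_lt.
  move=> nF S; cbv zeta; rewrite leNgt gt_max; apply/negP => /andP[l1 l2].
  move/lambda_min_gram_lt in l1; move/lambda_min_gram_lt in l2.
  by apply: nF; apply/FE; exists S.
rewrite probability_setC// EFinB leeB//.
set x := (N - m.+1.*2 + 2)%N in bound.
set Y := (_ ^+ x) in bound.
have NE : N = (x + m.*2)%N by rewrite /x; lia.
have x0 : (0 < x)%N by rewrite /x; lia.
have rateY a b : (a + b = x)%N -> 4 * (rate m sigma a * rate m sigma b) <= 4 * Y.
  move=> abx; rewrite ler_pM2l//; have := @rate_mul_le R m sigma a b (ltW sigma0).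
  by rewrite abx -NE => /(_ x0).
have PE (S : {set 'I_N}) a : #|S| = (m + a)%N -> (P (E S) <= (2 * rate m sigma a)%:E)%E.
  by move=> Sa; rewrite /E gram_event_prob//; exact: gauss_contracting_le.
have pair (S : {set 'I_N}) a b : (a + b = x)%N -> #|S| = (m + a)%N -> #|~: S| = (m + b)%N ->
    (P (E S `&` E (~: S)%SET) <= (4 * Y)%:E)%E.
  move=> abx Sa Sb; rewrite gram_event_indep//.
  apply: (le_trans (lee_pmul _ _ (PE _ _ Sa) (PE _ _ Sb))) => //.
  rewrite -EFinM lee_fin; apply: le_trans (rateY _ _ abx).
  by rewrite le_eqVlt; apply/orP; left; apply/eqP; ring.
(* A set of at most [m] columns has no tail bound of its own, but its complement has at least m + x
   columns. Shrinking that to exactly m + x gives the splitting 0 + x of the excess, covered by the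
   same estimate since [rate m sigma 0] is 1. *)
have small (S : {set 'I_N}) : (#|S| <= m)%N -> (P (E (~: S)%SET) <= (4 * Y)%:E)%E.
  move=> Sm; have Sc : (m + x <= #|~: S|)%N by have := cardsC S; rewrite card_ord; lia.
  have [S' S'S S'x] := exists_subset_card Sc.
  apply: (@le_trans _ _ (P (E S'))).
    apply: le_measure; rewrite ?inE// => w; exact: contracting_subset.
  apply: (le_trans (PE _ _ S'x)).
  have := rateY 0%N x (add0n x); rewrite lee_fin; apply: le_trans.
  have -> : rate m sigma 0 = 1 by rewrite /rate expr0.
  by rewrite mul1r ler_wpM2r ?rate_ge0 ?ler_nat// ltW.
have each (S : {set 'I_N}) : (P (E S `&` E (~: S)%SET) <= (4 * Y)%:E)%E.
  have SSc := cardsC S; rewrite card_ord in SSc.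
  have [Sm|Sm] := leqP #|S| m.
    apply: le_trans (small _ Sm).
    by apply: le_measure; rewrite ?inE// => w [].
  have [Sm'|Sm'] := leqP #|~: S| m.
    apply: le_trans (small _ Sm'); rewrite finset.setCK.
    by apply: le_measure; rewrite ?inE// => w [].
  by apply: (pair S (#|S| - m)%N (#|~: S| - m)%N); lia.
apply: (@le_trans _ _ (\sum_(S : {set 'I_N}) (4 * Y)%:E)%E).
  apply: le_trans (measure_bigsetU_le P _ mES) _.
  by apply: lee_sum => S _; exact: each.
rewrite sumEFin lee_fin sumr_const -cardsT -powersetT card_powerset cardsT card_ord.
by rewrite -[_ *+ _]mulr_natl natrX.
Qed.
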